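(* Let $N\ge2$, $M\ge1$, $k\ge0$ be integers and $f:[0,1]\to\mathbb R$ concave. For every density matrix $\rho$ on $\mathcal H_M$ and every unit vector $u\in\mathbb C^N$, $$\mathrm{Tr}_{\mathcal H_{M+k}} f\big(\widehat{\mathcal T}^k(\rho)\big)\;\ge\;\mathrm{Tr}_{\mathcal H_{M+k}} f\big(\widehat{\mathcal T}^k(|\otimes^M u\rangle\langle \otimes^M u|)\big).$$ Moreover, if $M\ge2$, $k>0$ and $f$ is strictly concave, equality holds if and only if $\rho=|\otimes^M w\rangle\langle\otimes^M w|$ for some unit vector $w\in\mathbb C^N$.
   Context: For $n\ge 0$, $\mathcal H_n=P_n(\mathbb C^N)^{\otimes n}$ is the totally symmetric subspace, $P_n$ the orthogonal projection with $P_n\, u_1\otimes\cdots\otimes u_n=\frac1{n!}\sum_{\sigma\in S_n}u_{\sigma(1)}\otimes\cdots\otimes u_{\sigma(n)}$. An operator $\Gamma$ on $\mathcal H_M$ is extended to $(\mathbb C^N)^{\otimes M}$ by $\Gamma=P_M\Gamma P_M$. For $k\ge0$ define the operator on $\mathcal H_{M+k}$ $$\mathcal T^k(\Gamma)=\frac{(M+k)!}{M!}\,P_{M+k}\big(I_{\mathbb C^N}^{\otimes k}\otimes\Gamma\big)P_{M+k},$$ which satisfies $\mathrm{Tr}\,\mathcal T^k(\Gamma)=\frac{(M+k+N-1)!}{(M+N-1)!}\mathrm{Tr}\,\Gamma$, and the trace-preserving normalization $\widehat{\mathcal T}^k=\frac{(M+N-1)!}{(M+k+N-1)!}\mathcal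 T^k$ (the universal $M$-to-$M+k$ cloning channel). $\otimes^M u=u\otimes\cdots\otimes u$. A density matrix is a positive semidefinite operator of trace one. *)

(* Defs.v *)
(* complex scalars are an arbitrary numClosedFieldType C. *)
From HB Require Import structures.
From mathcomp Require Import all_boot all_order all_algebra all_fingroup.
Set Implicit Arguments. Unset Strict Implicit. Unset Printing Implicit Defensive.
Import Order.TTheory GRing.Theory Num.Theory.
Local Open Scope ring_scope.
Local Open Scope sesquilinear_scope.

Section Defs.
Variable C : numClosedFieldType.

(* Basis of (C^N)^{(x) n} indexed by functions 'I_n -> 'I_N. *)
Definition Idx (N n : nat) := {ffun 'I_n -> 'I_N}.
Definition tdim (N n : nat) : nat := #|{: Idx N n}|.
Definition ix (N n : nat) (a : 'I_(tdim N n)) : Idx N n := enum_val a.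
Definition rk (N n : nat) (x : Idx N n) : 'I_(tdim N n) := enum_rank x.

(* Symmetrizer P_n on (C^N)^{(x) n}: P e_b = 1/n! sum_s e_(b o s). *)
Definition symP (N n : nat) : 'M[C]_(tdim N n) :=
  \matrix_(a, b)
    ((#|[set s : 'S_n | [ffun i => ix b (s i)] == ix a]|)%:R / (n`!)%:R).

(* I^{(x) k} (x) G, the first k tensor factors carry the identity. *)
Definition headI (N k M : nat) (a : 'I_(tdim N (k + M))) : Idx N k :=
  [ffun i => ix a (lshift M i)].
Definition tailI (N k M : nat) (a : 'I_(tdim N (k + M))) : Idx N M :=
  [ffun j => ix a (rshift k j)].
Definition idtens (N k M : nat) (G : 'M[C]_(tdim N M)) : 'M[C]_(tdim N (k + M)) :=
  \matrix_(a, b)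
    ((headI a == headI b)%:R * G (rk (tailI a)) (rk (tailI b))).

(* T^k and its trace-preserving normalization (cloning channel). *)
Definition calT (N M k : nat) (G : 'M[C]_(tdim N M)) : 'M[C]_(tdim N (k + M)) :=
  (((k + M)`!)%:R / (M`!)%:R) *: (symP N (k + M) *m idtens k G *m symP N (k + M)).
Definition calTh (N M k : nat) (G : 'M[C]_(tdim N M)) : 'M[C]_(tdim N (k + M)) :=
  (((M + N).-1`!)%:R / ((k + M + N).-1`!)%:R) *: calT k G.

(* |v><v| for a column vector v *)
Definition ketbra (D : nat) (v : 'cV[C]_D) : 'M[C]_D := v *m v ^t*.
(* the product vector  (x)^n u *)
Definition tensorpow (N n : nat) (u : 'cV[C]_N) : 'cV[C]_(tdim N n) :=
  \col_a \prod_(i < n) u (ix a i) 0.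

Definition unit_vector (D : nat) (u : 'cV[C]_D) : Prop := (u ^t* *m u) 0 0 = 1.

(* positive semidefinite: <v, A v> >= 0 for all v (and hermitian) *)
Definition psd (D : nat) (A : 'M[C]_D) : Prop :=
  A ^t* = A /\ forall v : 'cV[C]_D, 0 <= (v ^t* *m A *m v) 0 0.

(* density matrix of an operator on the range of the projector P,
   extended to the full space as P A P *)
Definition density_on (D : nat) (P A : 'M[C]_D) : Prop :=
  psd A /\ \tr A = 1 /\ A = P *m A *m P.

(* Tr_{range P} f(A): sum of f over the eigenvalues (with multiplicity) of the
   compression of A to the range of the orthogonal projector P, computed in an
   orthonormal basis (rows of V) of that range. *)
Definition trf_on (f : C -> C) (D : nat) (P A : 'M[C]_D) : C :=
  let V := schmidt (row_base P) in
  \sum_i f (spectral_diag (V *m A *m V ^t*) 0 i).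

(* concavity on [0,1] (real values of f there) *)
Definition concave01 (f : C -> C) : Prop :=
  (forall x, 0 <= x <= 1 -> f x \is Num.real) /\
  forall x y t, 0 <= x <= 1 -> 0 <= y <= 1 -> 0 <= t <= 1 ->
    t * f x + (1 - t) * f y <= f (t * x + (1 - t) * y).
Definition strictly_concave01 (f : C -> C) : Prop :=
  (forall x, 0 <= x <= 1 -> f x \is Num.real) /\
  forall x y t, 0 <= x <= 1 -> 0 <= y <= 1 -> 0 < t < 1 -> x != y ->
    t * f x + (1 - t) * f y < f (t * x + (1 - t) * y).

End Defs.

(* Main.v *)
Require Import Defs.
From HB Require Import structures.
From mathcomp Require Import all_boot all_order all_algebra all_fingroup.
From mathcomp Require Import ring zify.
Set Implicit Arguments. Unset Strict Implicit. Unset Printing Implicit Defensive.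
Import Order.TTheory GRing.Theory Num.Theory.
Local Open Scope ring_scope.
Local Open Scope sesquilinear_scope.

(* Write n = k + M, and let B chi = P_n (chi (x) phi), so that the image of
   |phi><phi| is a multiple of B B^*, which has the same nonzero spectrum as
   B^* B.  Commuting creation past annihilation operators gives
     C(n,M) B^* B = sum_l C(k,l) C(M,l) P_k (I (x) gamma_l) P_k,
   where gamma_l is the l-particle reduced density matrix of phi: the cloning
   operators on the right produce states of only k < n particles.  By induction
   on n and the Ky Fan principle, the sum of the j largest eigenvalues is maximal
   for coherent states, since for these all the terms on the right have a
   common eigenbasis sorting their spectra in the same order; numerically this is
   Vandermonde's identity.  Hence the spectrum of every output is majorized by
   that of a coherent state, and Karamata's inequality applies.
   If equality holds for a strictly concave f, the largest eigenvalues agree, so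
   there is a symmetric unit vector v with <v, (I (x) rho) v> = 1; then rho is
   pure, rho = |psi><psi|, and v = chi (x) psi.  A symmetric vector of this form
   forces psi to be a product vector. *)

(** * Linear algebra and majorization *)

(** The coherent output is never diagonalized. A closed formula [cohspec] for its spectrum is fixed
    in advance; every output is shown to be majorized by it, and for a coherent input Jensen's
    inequality in a rotated occupation basis, where [cohspec] is the diagonal, gives the reverse
    inequality between the sums of [f]. What shapes the recursion is that the slices of a pure
    state, which make up its reduced density matrices, are not normalized and have every size [l].
    The bound is therefore homogeneous in [phi], weighted by [symnorm], and [exc] lists the
    occupation states of all sizes in one order, so that the bounds for different [l] add index by
    index. Sizes are tied by an equation [n = k + M] between variables, since the recursion passes
    from [(n, k, M)] to [(k, k - l, l)]. Scalars lie in an arbitrary closed field, so concavity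
    enters only through chord slopes, with no derivatives, limits or suprema. *)

Section LinearAlgebra.
Variable C : numClosedFieldType.

Lemma trmxC_mul m n p (A : 'M[C]_(m, n)) (B : 'M[C]_(n, p)) :
  (A *m B)^t* = B^t* *m A^t*.
Proof. by rewrite trmx_mul map_mxM. Qed.

Lemma mxtrace_gram m n (X : 'M[C]_(m, n)) :
  \tr (X *m X^t*) = \sum_i \sum_j `|X i j| ^+ 2.
Proof.
rewrite /mxtrace; apply: eq_bigr => i _; rewrite mxE.
by apply: eq_bigr => j _; rewrite !mxE normCK.
Qed.

Lemma mxtrace_gram_ge0 m n (X : 'M[C]_(m, n)) : 0 <= \tr (X *m X^t*).
Proof.
rewrite mxtrace_gram; apply: sumr_ge0 => i _; apply: sumr_ge0 => j _.
exact: exprn_ge0.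
Qed.

(** [V^* V] is an orthogonal projector, and the difference of the two traces is the trace of the
    Gram matrix of [X - X V^* V]. *)
Lemma gram_contraction m n j (X : 'M[C]_(m, n)) (V : 'M[C]_(j, n)) :
  V \is unitarymx -> \tr (X *m V^t* *m (X *m V^t*)^t*) <= \tr (X *m X^t*).
Proof.
move=> /unitarymxP VV; rewrite -subr_ge0 -raddfB.
have -> : X *m X^t* - X *m V^t* *m (X *m V^t*)^t* =
   (X - X *m V^t* *m V) *m (X - X *m V^t* *m V)^t*.
  rewrite linearB /= map_mxB mulmxBl !mulmxBr !trmxC_mul !trmxCK.
  rewrite -[X *m V^t* *m V *m (V^t* *m _)]mulmxA [V *m (_ *m _)]mulmxA VV mul1mx.
  by rewrite !mulmxA subrr subr0.
exact: mxtrace_gram_ge0.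
Qed.

Lemma unitary_span_proj m n r (A : 'M[C]_(m, n)) (W : 'M[C]_(r, n)) :
  W \is unitarymx -> (A <= W)%MS -> A *m W^t* *m W = A.
Proof. by move=> Wu /submxP[Z ->]; rewrite mulmxtVK. Qed.

(** Moves a test frame for [B B^*] to one for [B^* B]. The rows of [W] are an orthonormal basis of
    the row space of [V B], so compressing to [W] loses nothing; dropping [V^* V] afterwards can
    only increase the trace. The frame may shrink when [B] makes rows dependent. *)
Lemma kyfan_exchange j n q (V : 'M[C]_(j, n)) (B : 'M[C]_(n, q)) :
  V \is unitarymx ->
  exists2 r, (r <= j)%N & exists2 W : 'M[C]_(r, q), W \is unitarymx &
    \tr (V *m (B *m B^t*) *m V^t*) <= \tr (W *m (B^t* *m B) *m W^t*).
Proof.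
move=> Vu; pose X := V *m B; exists (\rank X); first exact: rank_leq_row.
have Wu := @schmidt_unitarymx C _ _ (row_base X) (rank_leq_col _).
exists (schmidt (row_base X)) => //; set W := schmidt _ in Wu *.
have XW : X *m W^t* *m W = X.
  apply: unitary_span_proj => //.
  by apply: submx_trans (schmidt_sub _); rewrite eq_row_base.
have -> : V *m (B *m B^t*) *m V^t* = X *m W^t* *m (X *m W^t*)^t*.
  rewrite [in RHS]trmxC_mul trmxCK.
  by rewrite [in RHS]mulmxA XW [in RHS]trmxC_mul !mulmxA.
rewrite mxtrace_mulC; set Y := (X *m _)^t*.
have -> : Y *m (X *m W^t*) = (W *m B^t*) *m V^t* *m (W *m B^t* *m V^t*)^t*.
  by rewrite /Y /X !trmxC_mul !trmxCK !mulmxA.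
apply: le_trans (gram_contraction _ Vu) _.
by rewrite trmxC_mul trmxCK !mulmxA.
Qed.

Lemma range_basis_unitary n (P : 'M[C]_n) : schmidt (row_base P) \is unitarymx.
Proof. exact/schmidt_unitarymx/rank_leq_col. Qed.

Lemma range_basisK n (P : 'M[C]_n) : P *m P = P -> P^t* = P ->
  (schmidt (row_base P))^t* *m schmidt (row_base P) = P.
Proof.
move=> PP PC; have Vu := range_basis_unitary P; set V := schmidt _ in Vu *.
have /submxP[Z VZ] : (V <= P)%MS.
  by rewrite (eqmx_schmidt_free (row_base_free P)) eq_row_base.
have VP : V *m P = V by rewrite VZ -mulmxA PP.
have PV : P *m V^t* *m V = P.
  apply: unitary_span_proj => //.
  by apply: submx_trans (schmidt_sub _); rewrite eq_row_base.
by rewrite -[in LHS]VP trmxC_mul PC mulmxA PV.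
Qed.

Lemma mxrank_projector n (P : 'M[C]_n) : P *m P = P -> P^t* = P ->
  (\rank P)%:R = \tr P.
Proof.
move=> PP PC; rewrite -[in RHS](range_basisK PP PC) mxtrace_mulC.
by rewrite (unitarymxP (range_basis_unitary P)) mxtrace1.
Qed.

Lemma hermitian_spectral n (A : 'M[C]_n) : A^t* = A ->
  spectralmx A *m A *m (spectralmx A)^t* = diag_mx (spectral_diag A).
Proof.
move=> AH; have Uu := spectral_unitarymx A.
have /orthomx_spectralP {2}-> : A \is normalmx.
  by apply/normalmxP; rewrite AH.
rewrite !mulmxA mulmxV ?unitarymx_unit // mul1mx -mulmxA.
by rewrite (unitarymxP Uu) mulmx1.
Qed.

Lemma quad_rowsub j m n (s : 'I_j -> 'I_m) (U : 'M[C]_(m, n)) (A : 'M[C]_n) i :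
  (rowsub s U *m A *m (rowsub s U)^t*) i i = (U *m A *m U^t*) (s i) (s i).
Proof.
rewrite !mxE; apply: eq_bigr => a _; rewrite !mxE; congr (_ * _).
by apply: eq_bigr => b _; rewrite !mxE.
Qed.

Lemma rowsub_unitary j m n (s : 'I_j -> 'I_m) (U : 'M[C]_(m, n)) :
  injective s -> U \is unitarymx -> rowsub s U \is unitarymx.
Proof.
move=> sI /unitarymxP/matrixP UU; apply/unitarymxP/matrixP=> i k.
have := UU (s i) (s k); rewrite !mxE (inj_eq sI) => <-.
by apply: eq_bigr => a _; rewrite !mxE.
Qed.

End LinearAlgebra.

(** * Inequalities of Karamata and Jensen for a concave function on [0,1] *)

Section Concavity.
Variables (C : numClosedFieldType) (f : C -> C).
Hypothesis fconc : concave01 f.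

Let freal x : 0 <= x <= 1 -> f x \is Num.real. Proof. exact: fconc.1. Qed.

Let real01 (x : C) : 0 <= x <= 1 -> x \is Num.real.
Proof. by case/andP=> x0 _; exact: ger0_real. Qed.

(** Concavity with denominators cleared, so that each comparison of slopes reduces to a ring
    identity. *)
Lemma concave_three_points p q r : 0 <= p -> r <= 1 -> p < q -> q < r ->
  (r - q) * f p + (q - p) * f r <= (r - p) * f q.
Proof.
move=> p0 r1 pq qr; have pr : p < r by apply: lt_trans qr.
have rp : 0 < r - p by rewrite subr_gt0.
have rp0 : r - p != 0 by rewrite gt_eqF.
pose t := (r - q) / (r - p).
have t01 : 0 <= t <= 1.
  apply/andP; split; first by rewrite divr_ge0 ?subr_ge0 // ltW.
  by rewrite ler_pdivrMr // mul1r lerB // ltW.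
have := fconc.2 p r t; have -> : t * p + (1 - t) * r = q by rewrite /t; field.
rewrite p0 r1 (le_trans p0 (ltW pr)) (le_trans (ltW pr) r1).
move=> /(_ isT isT t01) /(ler_wpM2l (ltW rp)); congr (_ <= _).
by rewrite /t; field.
Qed.

Let slope x y := (f x - f y) / (x - y).

Let slopeC x y : slope x y = slope y x.
Proof. by rewrite /slope -opprB -[x - y]opprB invrN mulrNN. Qed.

Let slope_mono1 a b y : 0 <= a <= 1 -> 0 <= b <= 1 -> 0 <= y <= 1 ->
  b <= a -> a != y -> b != y -> slope a y <= slope b y.
Proof.
move=> a01 b01 y01; rewrite le_eqVlt => /orP[/eqP-> //|ba] ay bY.
have ay0 : a - y != 0 by rewrite subr_eq0.
have by0 : b - y != 0 by rewrite subr_eq0.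
have [a0 a1] := andP a01; have [b0 b1] := andP b01; have [y0 y1] := andP y01.
rewrite -subr_ge0.
have -> : slope b y - slope a y =
  (f b * (a - y) - f a * (b - y) - f y * (a - b)) / ((b - y) * (a - y)).
  by rewrite /slope; field; rewrite ay0 by0.
have [yb|yb] := real_ltP (real01 y01) (real01 b01).
  have ya := lt_trans yb ba.
  apply: divr_ge0; last by rewrite mulr_ge0 ?subr_ge0 // ltW.
  have := concave_three_points y0 a1 yb ba; rewrite -subr_ge0; congr (_ <= _).
  by ring.
have {}yb : b < y by rewrite lt_neqAle bY.
have [ya|ya] := real_ltP (real01 y01) (real01 a01).
  rewrite -[_ / _]opprK -mulrN -invrN -mulNr.
  apply: divr_ge0; last by rewrite -mulNr opprB mulr_ge0 ?subr_ge0 // ltW.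
  have := concave_three_points b0 a1 yb ya; rewrite -subr_ge0; congr (_ <= _).
  by ring.
have {}ya : a < y by rewrite lt_neqAle ay.
apply: divr_ge0; last by rewrite -mulrNN !opprB mulr_ge0 ?subr_ge0 // ltW.
have := concave_three_points b0 y1 ba ya; rewrite -subr_ge0; congr (_ <= _).
by ring.
Qed.

Let slope_mono x1 y1 x2 y2 :
  0 <= x1 <= 1 -> 0 <= y1 <= 1 -> 0 <= x2 <= 1 -> 0 <= y2 <= 1 ->
  x2 <= x1 -> y2 <= y1 -> x1 != y1 -> x2 != y2 -> slope x1 y1 <= slope x2 y2.
Proof.
move=> hx1 hy1 hx2 hy2 lx ly n1 n2.
(* The two ends of the chord are moved one after the other. If the intermediate chord from [x2] to
   [y1] degenerates, the one from [x1] to [y2] serves instead. *)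
have [e|n3] := eqVneq x2 y1.
  have l2 : y2 < x1.
    by apply: lt_le_trans lx; rewrite lt_neqAle eq_sym n2 e.
  apply: (@le_trans _ _ (slope x1 y2)).
    by rewrite slopeC [X in _ <= X]slopeC slope_mono1 // eq_sym // gt_eqF.
  by rewrite slope_mono1 // gt_eqF.
apply: (@le_trans _ _ (slope x2 y1)); first exact: slope_mono1.
by rewrite slopeC [X in _ <= X]slopeC slope_mono1 // eq_sym.
Qed.

Let in01 (z : C * C) := (0 <= z.1 <= 1) && (0 <= z.2 <= 1).
Let above (z w : C * C) := (w.1 <= z.1) && (w.2 <= z.2).

(* Abel summation; [X] carries the (nonpositive) sum of the differences already
   consumed and [c] a lower bound of the remaining chord slopes. *)
Let abel_slopes (zs : seq (C * C)) X c : c \is Num.real ->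
  all in01 zs -> pairwise above zs ->
  {in zs, forall z, z.1 != z.2 -> c <= slope z.1 z.2} ->
  (forall j, X + \sum_(z <- take j zs) (z.1 - z.2) <= 0) ->
  X + \sum_(z <- zs) (z.1 - z.2) = 0 ->
  - (c * X) <= \sum_(z <- zs) (f z.1 - f z.2).
Proof.
elim: zs X c => [|[x y] zs IH] X c cr.
  by move=> _ _ _ _; rewrite !big_nil addr0 => ->; rewrite mulr0 oppr0.
rewrite [all _ _]/= [pairwise _ _]/= => /andP[/andP[hx hy] zs01].
move=> /andP[/allP xyzs zsp] cs tX sX; rewrite /= in hx hy.
have X0 : X <= 0 by have := tX 0%N; rewrite take0 big_nil addr0.
have [e|n] := eqVneq x y.
  rewrite big_cons /= e subrr add0r; apply: IH => //.
  - by move=> z zi; apply: cs; rewrite inE zi orbT.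
  - by move=> j; have := tX j.+1; rewrite /= big_cons /= e subrr add0r.
  - by have := sX; rewrite big_cons /= e subrr add0r.
have xy0 : x - y != 0 by rewrite subr_eq0.
have cxy : c <= slope x y by apply: (cs (x, y)) => //; rewrite mem_head.
have := IH (X + (x - y)) (slope x y) _ zs01 zsp.
have sr : slope x y \is Num.real by rewrite realM ?realV ?realB ?freal ?real01.
move=> /(_ sr) H; rewrite big_cons /=.
have {}H : - (slope x y * (X + (x - y))) <= \sum_(z <- zs) (f z.1 - f z.2).
  apply: H.
  - move=> z zi nz; have /andP[? ?] := xyzs _ zi.
    by have /andP[? ?] := allP zs01 _ zi; apply: slope_mono.
  - by move=> j; have := tX j.+1; rewrite /= big_cons /= addrA.
  - by have := sX; rewrite big_cons /= addrA.
apply: le_trans (_ : (f x - f y) - slope x y * (X + (x - y)) <= _); last first.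
  by rewrite lerD2l.
have -> : f x - f y - slope x y * (X + (x - y)) = slope x y * (- X).
  by rewrite /slope; field.
by rewrite -mulrN ler_wpM2r // oppr_ge0.
Qed.

(** Both coordinates decrease along the list, so the chord slopes of [f] increase; they are summed
    by parts against the nonpositive partial sums of [z.1 - z.2]. *)
Lemma karamata (zs : seq (C * C)) : all in01 zs -> pairwise above zs ->
  (forall j, \sum_(z <- take j zs) z.1 <= \sum_(z <- take j zs) z.2) ->
  \sum_(z <- zs) z.1 = \sum_(z <- zs) z.2 ->
  \sum_(z <- zs) f z.2 <= \sum_(z <- zs) f z.1.
Proof.
move=> zs01 zsp tzs szs; rewrite -subr_ge0 -sumrB.
(* The first nondegenerate chord has the least slope. *)
have [c cr cs] : exists2 c, c \is Num.real &
    {in zs, forall z, z.1 != z.2 -> c <= slope z.1 z.2}.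
  elim: zs zs01 zsp {tzs szs} => [|[x y] zs IH]; first by exists 0.
  rewrite [all _ _]/= [pairwise _ _]/= => /andP[/andP[hx hy] zs01].
  move=> /andP[/allP xyzs zsp]; rewrite /= in hx hy.
  have [e|n] := eqVneq x y.
    have [c cr cs] := IH zs01 zsp; exists c => // z; rewrite inE.
    by case/orP=> [/eqP->|/cs //]; rewrite e eqxx.
  exists (slope x y); first by rewrite realM ?realV ?realB ?freal ?real01.
  move=> z; rewrite inE => /orP[/eqP-> //|zi nz].
  have /andP[? ?] := xyzs _ zi.
  by have /andP[? ?] := allP zs01 _ zi; apply: slope_mono.
have := @abel_slopes zs 0 c cr zs01 zsp cs; rewrite mulr0 oppr0; apply.
  by move=> j; rewrite add0r sumrB subr_le0.
by rewrite add0r sumrB szs subrr.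
Qed.

Lemma karamata_seq D (x mu : nat -> C) :
  (forall p, (p < D)%N -> 0 <= x p <= 1) -> (forall p, 0 <= mu p <= 1) ->
  (forall p q, (p < q < D)%N -> x q <= x p) ->
  (forall p q, (p < q)%N -> mu q <= mu p) ->
  (forall j, (j <= D)%N -> \sum_(p < j) x p <= \sum_(p < j) mu p) ->
  \sum_(p < D) x p = \sum_(p < D) mu p ->
  \sum_(p < D) f (mu p) <= \sum_(p < D) f (x p).
Proof.
move=> x01 mu01 xd mud maj tot; pose zs := [seq (x p, mu p) | p <- iota 0 D].
have sE j (F : C * C -> C) : \sum_(z <- [seq (x p, mu p) | p <- iota 0 j]) F z =
    \sum_(p < j) F (x p, mu p).
  by rewrite big_map -{1}(subn0 j) -/(index_iota 0 j) big_mkord.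
have zsD (F : C * C -> C) : \sum_(z <- zs) F z = \sum_(p < D) F (x p, mu p) by apply: sE.
have := @karamata zs; rewrite !zsD; apply=> //.
- apply/allP => z /mapP[p]; rewrite mem_iota => /= pD ->.
  by rewrite /in01 /= x01 // mu01.
- rewrite /zs pairwise_map; apply/(pairwiseP 0%N) => p q.
  rewrite !inE size_iota => pD qD pq; rewrite !nth_iota // !add0n /above /=.
  by rewrite xd ?pq // mud.
move=> j; rewrite /zs -map_take take_iota !sE; apply: maj; exact: geq_minr.
Qed.

(** Equality need not be traced through the summation by parts. The midpoints of [x] and [mu] still
    majorize [x], so their [f]-sum is at most that of [x]; but if the first terms differed, strict
    concavity there would make it exceed the average of the two equal [f]-sums. *)
Lemma karamata_strict D (x mu : nat -> C) : strictly_concave01 f -> (0 < D)%N ->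
  (forall p, (p < D)%N -> 0 <= x p <= 1) -> (forall p, 0 <= mu p <= 1) ->
  (forall p q, (p < q < D)%N -> x q <= x p) ->
  (forall p q, (p < q)%N -> mu q <= mu p) ->
  (forall j, (j <= D)%N -> \sum_(p < j) x p <= \sum_(p < j) mu p) ->
  \sum_(p < D) x p = \sum_(p < D) mu p ->
  \sum_(p < D) f (x p) = \sum_(p < D) f (mu p) -> x 0%N = mu 0%N.
Proof.
move=> fs D0 x01 mu01 xd mud maj tot feq; apply/eqP/negPn/negP => ne.
have half : 1 - 2^-1 = 2^-1 :> C by field.
have h01 : 0 < (2^-1 : C) < 1.
  by rewrite invr_gt0 ltr0n invf_cp1 ?ltr0n ?ltr1n.
have h01' : 0 <= (2^-1 : C) <= 1 by case/andP: h01 => h0 h1; rewrite !ltW.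
(* [x] is controlled only below [D], while the majorizing sequence must decrease within [0,1] on all
   of [nat]; the value 0 beyond [D] ensures this. *)
pose mid p := if (p < D)%N then 2^-1 * x p + (1 - 2^-1) * mu p else 0.
have midE p : (p < D)%N -> mid p = 2^-1 * x p + 2^-1 * mu p.
  by move=> pD; rewrite /mid pD half.
have sumE j : (j <= D)%N -> \sum_(p < j) mid p =
    2^-1 * \sum_(p < j) x p + 2^-1 * \sum_(p < j) mu p.
  move=> jD; rewrite !mulr_sumr -big_split; apply: eq_bigr => p _.
  by rewrite midE // (leq_trans _ jD).
have h2 : 0 <= (2^-1 : C) by case/andP: h01'.
have mid01 p : 0 <= mid p <= 1.
  rewrite /mid half; case: ifP => pD; last by rewrite lexx ler01.
  have /andP[x0 x1] := x01 p pD; have /andP[m0 m1] := mu01 p.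
  rewrite addr_ge0 ?mulr_ge0 //= -[leRHS](_ : 2^-1 * 1 + 2^-1 * 1 = 1); last by field.
  by rewrite lerD // ler_wpM2l.
have le1 : \sum_(p < D) f (mid p) <= \sum_(p < D) f (x p).
  apply: karamata_seq => //.
  - move=> p q pq; case: (ltnP q D) => qD; last first.
      by rewrite {1}/mid ltnNge qD; case/andP: (mid01 p).
    by rewrite !midE // ?(ltn_trans pq) // lerD // ler_wpM2l ?xd ?mud // pq.
  - move=> j jD; rewrite sumE // -[leLHS](_ : 2^-1 * \sum_(p < j) x p +
      2^-1 * \sum_(p < j) x p = _); last by field.
    by rewrite lerD2l ler_wpM2l // maj.
  by rewrite sumE // -tot; field.
suff : \sum_(p < D) f (x p) < \sum_(p < D) f (mid p).
  by move/lt_le_trans/(_ le1); rewrite ltxx.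
have {1}-> : \sum_(p < D) f (x p) =
    \sum_(p < D) (2^-1 * f (x p) + (1 - 2^-1) * f (mu p)).
  by rewrite big_split -!mulr_sumr /= -feq half; field.
rewrite (bigD1 (Ordinal D0)) //= [ltRHS](bigD1 (Ordinal D0)) //=.
apply: ltr_leD; first by rewrite /mid D0 fs.2 // x01.
apply: ler_sum => p _; rewrite {1}/mid ltn_ord; apply: fconc.2 => //.
exact: x01.
Qed.

Lemma jensen (I : finType) (t x : I -> C) :
  (forall i, 0 <= t i) -> \sum_i t i = 1 -> (forall i, 0 <= x i <= 1) ->
  \sum_i t i * f (x i) <= f (\sum_i t i * x i).
Proof.
move=> t0 t1 x01.
have mean01 s : 0 < \sum_(i <- s) t i ->
  0 <= (\sum_(i <- s) t i * x i) / \sum_(i <- s) t i <= 1.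
  move=> T0; rewrite divr_ge0 ?(ltW T0) ?sumr_ge0 //=; last first.
    by move=> i _; rewrite mulr_ge0 //; case/andP: (x01 i).
  rewrite ler_pdivrMr // mul1r ler_sum // => i _.
  by rewrite ler_piMr //; case/andP: (x01 i).
suff main s : 0 < \sum_(i <- s) t i -> \sum_(i <- s) t i * f (x i) <=
   (\sum_(i <- s) t i) * f ((\sum_(i <- s) t i * x i) / \sum_(i <- s) t i).
  by have := main (index_enum I); rewrite t1 mul1r divr1; apply.
elim: s => [|i s IH]; first by rewrite big_nil ltxx.
rewrite !big_cons.
have : 0 <= \sum_(j <- s) t j by rewrite sumr_ge0.
(* When the remaining weights all vanish their mean is a division by zero, so this case is separated
   from the induction. *)
rewrite le_eqVlt => /orP[/eqP T0|T0].
  have st j : j \in s -> t j = 0.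
    move=> js; move/esym/eqP: T0; rewrite psumr_eq0 //.
    by move/allP/(_ _ js)/eqP.
  rewrite -T0 !addr0 => ti0.
  rewrite [X in _ + X]big_seq big1 ?addr0 => [|j /st ->]; last by rewrite mul0r.
  rewrite [X in t i * x i + X]big_seq big1 ?addr0 => [|j /st ->].
    by rewrite mulrAC divff ?gt_eqF // mul1r.
  by rewrite mul0r.
move=> TT0; set T := \sum_(j <- s) t j in T0 TT0 IH *.
set y := (\sum_(j <- s) t j * x j) / T in IH *.
have TTn : t i + T != 0 by rewrite gt_eqF.
have Tn : T != 0 by rewrite gt_eqF.
have y01 : 0 <= y <= 1 by apply: mean01.
have w01 : 0 <= t i / (t i + T) <= 1.
  by rewrite divr_ge0 ?(ltW TT0) //= ler_pdivrMr // mul1r lerDl ltW.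
have := fconc.2 _ _ _ (x01 i) y01 w01.
have -> : t i / (t i + T) * x i + (1 - t i / (t i + T)) * y =
  (t i * x i + \sum_(j <- s) t j * x j) / (t i + T).
  by rewrite /y; field; rewrite TTn Tn.
move=> /(ler_wpM2l (ltW TT0)); apply: le_trans.
have -> : (t i + T) * (t i / (t i + T) * f (x i) + (1 - t i / (t i + T)) * f y)
  = t i * f (x i) + T * f y by field.
by rewrite lerD2l IH.
Qed.

End Concavity.

(** The enumeration is total on [nat], with a default index past the end, to match the sequences in
    Karamata's inequality. The sum is stated for every [F] because it is used both for [f] and for
    the trace. *)
Lemma sort_family (C : numClosedFieldType) D (lam : 'I_D -> C) :
  (forall i, lam i \is Num.real) -> (0 < D)%N ->
  exists e : nat -> 'I_D,
    [/\ forall p q, (p < q < D)%N -> lam (e q) <= lam (e p),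
        forall F : C -> C, \sum_(p < D) F (lam (e p)) = \sum_i F (lam i) &
        forall j, (j <= D)%N -> injective (fun a : 'I_j => e a)].
Proof.
move=> lamr D0; pose le i j := lam j <= lam i; pose s := sort le (enum 'I_D).
have szs : size s = D by rewrite size_sort size_enum_ord.
have us : uniq s by rewrite sort_uniq enum_uniq.
exists (nth (Ordinal D0) s); split.
- move=> p q /andP[pq qD].
  have le_tot : total le by move=> i j; rewrite /le real_leVge // lamr.
  have le_tr : transitive le by move=> i j l ji lj; exact: le_trans lj ji.
  have le_refl : reflexive le by move=> i; exact: lexx.
  have := sorted_leq_nth le_tr le_refl (Ordinal D0) (sort_sorted le_tot (enum 'I_D)).
  move/(_ p q); rewrite !inE -/s szs qD (ltn_trans pq qD); apply => //.
  exact: ltnW.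
- have ps : perm_eq s (enum 'I_D) by rewrite perm_sort.
  move=> F; rewrite -[RHS]big_enum -(perm_big _ ps) /=.
  by rewrite [RHS](big_nth (Ordinal D0)) szs big_mkord.
move=> j jD a b /eqP; rewrite nth_uniq ?szs ?(leq_trans _ jD) // => /eqP.
exact: val_inj.
Qed.

(** * Occupation numbers *)

Section Occupation.
Variable N : nat.
Local Notation occv := {ffun 'I_N -> nat}.

Definition occ n (x : Idx N n) : occv := [ffun i => \sum_(j < n) (x j == i)]%N.
Definition oadd (p q : occv) : occv := [ffun i => (p i + q i)%N].

Lemma oaddE p q i : oadd p q i = (p i + q i)%N. Proof. by rewrite ffunE. Qed.

Lemma sum_occ n (x : Idx N n) : (\sum_i occ x i = n)%N.
Proof.
under eq_bigr do rewrite ffunE; rewrite exchange_big /=.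
rewrite -[RHS]card_ord -sum1_card; apply: eq_bigr => j _.
by rewrite (bigD1 (x j)) //= eqxx big1 // => i /negPf; rewrite eq_sym => ->.
Qed.

Definition wcons n (ix : 'I_N * Idx N n) : Idx N n.+1 :=
  [ffun j => if unlift ord0 j is Some j' then ix.2 j' else ix.1].

Lemma wcons_bij n : bijective (@wcons n).
Proof.
exists (fun x : Idx N n.+1 => (x ord0, [ffun j => x (lift ord0 j)])).
  case=> i x; rewrite ffunE unlift_none; congr pair.
  by apply/ffunP=> j; rewrite !ffunE liftK.
move=> x; apply/ffunP=> j; rewrite ffunE /=.
by case: unliftP => [j' ->|->] //; rewrite ffunE.
Qed.

Lemma occ_wcons n (z : 'I_N * Idx N n) i :
  occ (wcons z) i = ((z.1 == i) + occ z.2 i)%N.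
Proof.
rewrite !ffunE big_ord_recl !ffunE unlift_none; congr (_ + _)%N.
by apply: eq_bigr => j _; rewrite !ffunE liftK.
Qed.

(** The multinomial coefficient, written as a product to stay in [nat]. Induction on [n] splits off
    the first letter [i], which leaves the occupation [pre i]. *)
Lemma card_occ n (m : occv) :
  (#|[set x : Idx N n | occ x == m]| * \prod_i (m i)`!
    = if (\sum_i m i == n)%N then n`! else 0)%N.
Proof.
elim: n m => [|n IH] m.
  case: ifP => [|mN0].
    rewrite sum_nat_eq0 => /forallP m0.
    have {}m0 i : m i = 0%N by apply/eqP; apply: (implyP (m0 i)).
    rewrite big1 => [|i _]; last by rewrite m0.
    rewrite muln1 (_ : [set x | _] = [set: Idx N 0]).
      by rewrite cardsT card_ffun !card_ord expn0.
    by apply/setP=> x; rewrite !inE; apply/eqP/ffunP=> i; rewrite ffunE big_ord0.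
  apply/eqP; rewrite muln_eq0 cards_eq0; apply/orP; left.
  apply/eqP/setP=> x; rewrite !inE; apply/eqP=> xm.
  by move: mN0; rewrite -xm sum_occ eqxx.
pose pre i : occv := [ffun i' => (m i' - (i == i'))%N].
have -> : (#|[set x : Idx N n.+1 | occ x == m]|
   = \sum_i (0 < m i) * #|[set x : Idx N n | occ x == pre i]|)%N.
  rewrite -sum1_card (reindex (@wcons n)) /=; last exact/onW_bij/wcons_bij.
  under eq_bigl => z do rewrite inE.
  rewrite -(pair_big_dep xpredT (fun i x => occ (wcons (i, x)) == m)
    (fun _ _ => 1%N)) /=.
  apply: eq_bigr => i _; rewrite -sum1_card.
  case: posnP => [mi0|mi]; rewrite ?mul0n ?mul1n.
    rewrite big_pred0 // => x; apply/eqP=> /ffunP/(_ i).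
    by rewrite occ_wcons eqxx mi0.
  apply: eq_bigl => x; rewrite inE; apply/eqP/eqP => /ffunP e; apply/ffunP=> i'.
    by rewrite [RHS]ffunE -e occ_wcons addKn.
  rewrite occ_wcons /= e ffunE; case: eqVneq => [<-|_]; first by lia.
  by rewrite subn0.
have pref i : (0 < m i)%N ->
   (\prod_i' (m i')`! = m i * \prod_i' (pre i i')`!)%N.
  move=> mi; rewrite (bigD1 i) //= [X in (_ = _ * X)%N](bigD1 i) //= mulnA.
  congr (_ * _)%N.
    by rewrite ffunE eqxx; case: (m i) mi => // q _; rewrite subn1 factS.
  by apply: eq_bigr => i' ni; rewrite ffunE eq_sym (negPf ni) subn0.
have sumpre i : (0 < m i)%N -> (\sum_i' m i' = (\sum_i' pre i i').+1)%N.
  move=> mi; rewrite (bigD1 i) //= [X in (_ = X.+1)%N](bigD1 i) //=.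
  rewrite ffunE eqxx -addSn; congr (_ + _)%N; first by lia.
  by apply: eq_bigr => i' ni; rewrite ffunE eq_sym (negPf ni) subn0.
rewrite big_distrl /=.
transitivity (\sum_i m i * if (\sum_i m i == n.+1)%N then n`! else 0)%N.
  apply: eq_bigr => i _; case: posnP => [->|mi]; first by rewrite !mul0n.
  by rewrite mul1n (pref _ mi) mulnCA IH (sumpre _ mi) eqSS.
rewrite -big_distrl /=; case: ifP => [/eqP->|]; first by rewrite factS.
by rewrite muln0.
Qed.

Lemma occ_perm n (x y : Idx N n) : occ x = occ y ->
  exists s : 'S_n, forall i, x i = y (s i).
Proof.
move=> /ffunP xy.
have cnt (z : Idx N n) i : count_mem i [tuple z j | j < n] = occ z i.
  rewrite ffunE -sum1_count big_map big_mkcond /= big_enum /=.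
  by apply: eq_bigr => j _; case: eqP.
have /tuple_permP[s e] : perm_eq [tuple x j | j < n] [tuple y j | j < n].
  by apply/allP => i _; rewrite /= !cnt xy.
exists s => i; have /(congr1 (fun u => nth (x i) u i)) := e.
by rewrite -!tnth_nth !tnth_mktuple.
Qed.

Lemma occ_comp_perm n (x : Idx N n) (s : 'S_n) : occ [ffun i => x (s i)] = occ x.
Proof.
apply/ffunP=> i; rewrite !ffunE; under eq_bigr do rewrite ffunE.
by rewrite [RHS](reindex_inj (@perm_inj _ s)).
Qed.

(** Orbit counting: the fibres of [s |-> b o s] over the words with the occupation of [b] are
    translates of each other, hence equal in size; there are [n!] permutations, and the multinomial
    formula counts the words. *)
Lemma card_perm_occ n (a b : Idx N n) :
  (#|[set s : 'S_n | [ffun i => b (s i)] == a]|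
    = (occ a == occ b) * \prod_i (occ b i)`!)%N.
Proof.
pose c x := #|[set s : 'S_n | [ffun i => b (s i)] == x]|.
have cE x : occ x = occ b -> c x = c b.
  move=> /occ_perm[s xs]; rewrite /c -(card_imset _ (mulgI s^-1%g)).
  apply: eq_card => u; rewrite inE; apply/imsetP/eqP.
    case=> v; rewrite inE => /eqP/ffunP e ->; apply/ffunP=> i.
    by have := e ((s^-1)%g i); rewrite !ffunE permM xs permKV.
  move=> /ffunP e; exists (s * u)%g; last by rewrite mulKg.
  rewrite inE; apply/eqP/ffunP=> i; rewrite ffunE permM xs.
  by have := e (s i); rewrite ffunE.
have c0 x : occ x != occ b -> c x = 0%N.
  move=> nx; apply/eqP; rewrite cards_eq0; apply/eqP/setP=> s; rewrite !inE.
  by apply/negP=> /eqP e; move: nx; rewrite -e occ_comp_perm eqxx.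
have sumc : (#|[set x : Idx N n | occ x == occ b]| * c b = n`!)%N.
  rewrite -(card_Sn n) -[in RHS]sum1_card.
  rewrite [RHS](partition_big (fun s : 'S_n => [ffun i => b (s i)] : Idx N n)
     (mem [set x | occ x == occ b])) /=.
    rewrite -sum_nat_const; apply: eq_bigr => x; rewrite inE => /eqP /cE <-.
    by rewrite sum1dep_card; apply: eq_card => s; rewrite !inE.
  by move=> s _; rewrite inE occ_comp_perm.
have := card_occ n (occ b); rewrite sum_occ eqxx -{}sumc => /eqP.
rewrite -/(c a) eqn_pmul2l; last by apply/card_gt0P; exists b; rewrite inE.
move/eqP=> ->; case: eqVneq => [/cE ->|/c0 ->]; by rewrite ?mul1n ?mul0n.
Qed.

Variable C : numClosedFieldType.

(* The inverse of the number of words with occupation [p]. *)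
Definition occw n (p : occv) : C := (\prod_i (p i)`!)%:R / (n`!)%:R.

(* The entry of the symmetrizer [P_n] at the word [a] and the concatenation of [h]
   and [t], in a form needing no cast between [n] and [k + M]. *)
Definition occK n k M (a : Idx N n) (h : Idx N k) (t : Idx N M) : C :=
  (occ a == oadd (occ h) (occ t))%:R * occw n (occ a).

Lemma natr_fact_neq0 n : (n`!)%:R != 0 :> C.
Proof. by rewrite pnatr_eq0 -lt0n fact_gt0. Qed.
Hint Resolve natr_fact_neq0 : core.

Lemma occw_gt0 n p : 0 < occw n p.
Proof.
apply: divr_gt0; rewrite ltr0n ?fact_gt0 //.
by apply: prodn_gt0 => i; apply: fact_gt0.
Qed.

Lemma symPE n a b : symP C N n a b = (occ (ix a) == occ (ix b))%:R * occw n (occ (ix a)).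
Proof.
rewrite mxE card_perm_occ natrM -mulrA.
by case: eqVneq => [->|_]; rewrite ?mul0r.
Qed.

(** A multinomial count of the words with occupation [p - q]. The indicators annul the product
    wherever the subtraction would be truncated, so the count factors over the modes without side
    conditions. *)
Lemma sum_occ_eq n (p q : occv) : (\sum_i p i = \sum_i q i + n)%N ->
  \sum_(s : Idx N n) (p == oadd q (occ s))%:R =
  (n`!)%:R * \prod_i ((q i <= p i)%:R / ((p i - q i)`!)%:R) :> C.
Proof.
move=> pq; have [/forallP qp|] := boolP [forall i, q i <= p i]%N.
  pose m : occv := [ffun i => (p i - q i)%N].
  have mE i : (p i = q i + m i)%N by rewrite ffunE subnKC.
  have sm : (\sum_i m i == n)%N.
    by rewrite -(eqn_add2l (\sum_i q i)) -pq -big_split /=; apply/eqP/eq_bigr.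
  have := card_occ n m; rewrite sm => mn.
  transitivity (#|[set x : Idx N n | occ x == m]|%:R : C).
    rewrite -sum1dep_card natr_sum [RHS]big_mkcond /=; apply: eq_bigr => s _.
    case: (eqVneq (occ s) m) => [->|ne].
      by case: eqP => // -[]; apply/ffunP=> i; rewrite oaddE mE.
    case: eqP => // /ffunP e; case/eqP: ne; apply/ffunP=> i.
    by apply/eqP; rewrite -(eqn_add2l (q i)) -mE e oaddE.
  rewrite -mn natrM -mulrA natr_prod -big_split /= big1 ?mulr1 // => i _.
  by rewrite qp ffunE mul1r divff.
rewrite negb_forall => /existsP[i qpi].
rewrite (bigD1 i) //= (negPf qpi) mul0r mul0r mulr0 big1 // => s _.
by case: eqP => // /ffunP/(_ i); rewrite oaddE => pE; move: qpi; rewrite pE leq_addr.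
Qed.

(** Occupation vectors with entries at most [L] form a finite type, over which one can sum and
    exchange sums with products over modes. *)
Definition ocast L (x : {ffun 'I_N -> 'I_L.+1}) : occv := [ffun i => val (x i)].

(** Words are grouped by occupation, with multinomial weights. The bound [L] is free so that sums
    over words of different lengths can be merged in one box. *)
Lemma sum_word n L (F : occv -> C) : (n <= L)%N ->
  \sum_(a : Idx N n) F (occ a) = \sum_(x : {ffun 'I_N -> 'I_L.+1})
    (\sum_i x i == n)%N%:R * ((n`!)%:R * \prod_i ((x i)`!)%:R^-1) * F (ocast x).
Proof.
move=> nL; have bnd (a : Idx N n) i : (occ a i < L.+1)%N.
  by rewrite ltnS (leq_trans _ nL) // -[leqRHS](sum_occ a) (bigD1 i) //= leq_addr.
transitivity (\sum_(x : {ffun 'I_N -> 'I_L.+1}) \sum_(a : Idx N n)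
    (ocast x == occ a)%:R * F (ocast x)).
  rewrite exchange_big /=; apply: eq_bigr => a _.
  pose x := [ffun i => Ordinal (bnd a i)].
  have xa : ocast x = occ a by apply/ffunP=> i; rewrite !ffunE.
  rewrite (bigD1 x) //= xa eqxx mul1r big1 ?addr0 // => y ny.
  case: eqP => [e|]; rewrite ?mul0r //; case/eqP: ny; apply/ffunP=> i.
  by apply/val_inj; move/ffunP/(_ i): e; rewrite -xa !ffunE.
apply: eq_bigr => x _; rewrite -mulr_suml; congr (_ * _).
pose z : occv := [ffun=> 0%N].
have sz : (\sum_i z i = 0)%N by apply: big1 => i _; rewrite ffunE.
have se : (\sum_i ocast x i = \sum_i x i)%N by apply: eq_bigr => i _; rewrite ffunE.
transitivity (\sum_(a : Idx N n) (ocast x == oadd z (occ a))%:R : C).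
  by apply: eq_bigr => a _; congr ((_ == _)%:R); apply/ffunP=> i; rewrite !ffunE.
case: eqP => [e|ne]; last first.
  rewrite mul0r big1 // => a _; case: eqP => // E; case: ne.
  rewrite -se E -[RHS](sum_occ a); apply: eq_bigr => i _.
  by rewrite oaddE ffunE.
rewrite sum_occ_eq ?sz ?se // mul1r; congr (_ * _); apply: eq_bigr => i _.
by rewrite !ffunE subn0 mul1r.
Qed.

(** The normal ordering identity in a single mode. After clearing factorials it is Vandermonde's
    convolution $\sum_x \binom{p}{x}\binom{m}{p'-x}=\binom{p+m}{p'}$, and the balance
    [p' + m' = p + m] turns $\binom{p+m}{p'}\,p'!\,m'!$ into $(p+m)!$. The range [L] is common to
    all modes. *)
Lemma vandermonde_mode L (p p' m m' : nat) : (p <= L)%N -> (p' + m' = p + m)%N ->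
  \sum_(x < L.+1) ((x`!)%:R^-1 * ((x <= p')%:R / ((p' - x)`!)%:R) *
     ((x <= p)%:R / ((p - x)`!)%:R) *
     ((p' <= m + x)%:R / ((m + x - p')`!)%:R)) * ((p`!)%:R * (p'`!)%:R * (m`!)%:R * (m'`!)%:R)
  = ((p + m)`!)%:R :> C.
Proof.
move=> pL e.
have -> : ((p + m)`!)%:R =
    (\sum_(x < p'.+1) 'C(p, x) * 'C(m, p' - x))%:R * ((p'`!)%:R * (m'`!)%:R) :> C.
  rewrite binomial.Vandermonde -!natrM; congr (_%:R).
  by rewrite -(@bin_fact (p + m) p') -?e ?leq_addr // addKn.
rewrite natr_sum mulr_suml.
pose F x : C := ('C(p, x) * 'C(m, p' - x))%:R * ((p'`!)%:R * (m'`!)%:R).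
have binE a b : (b <= a)%N -> 'C(a, b)%:R = (a`!)%:R / ((b`!)%:R * ((a - b)`!)%:R) :> C.
  move=> ba; rewrite -(bin_fact ba) !natrM mulfK // mulf_neq0 //.
transitivity (\sum_(x < L.+1 | (x < p'.+1)%N) F x).
  rewrite [RHS]big_mkcond; apply: eq_bigr => x _.
  rewrite ltnS; case: leqP => xp'; last by rewrite !(mul0r, mulr0).
  rewrite /F; case: (leqP x p) => xp; last first.
    by rewrite bin_small // !(mul0r, mulr0).
  case: (leqP p' (m + x)) => pmx; last first.
    by rewrite [X in (_ * X)%N]bin_small ?muln0 ?(mul0r, mulr0) //; lia.
  rewrite natrM !binE //; last by lia.
  have -> : (m - (p' - x) = m + x - p')%N by lia.
  move: (natr_fact_neq0 x) (natr_fact_neq0 (p' - x)).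
  move: (natr_fact_neq0 (p - x)) (natr_fact_neq0 (m + x - p')).
  set a := (x`!)%:R; set b := ((p' - x)`!)%:R; set c := ((p - x)`!)%:R.
  set d := ((m + x - p')`!)%:R => d0 c0 b0 a0.
  by rewrite /=; field; rewrite a0 b0 c0 d0.
rewrite -(big_mkord (fun x => x < p'.+1)%N F).
transitivity (\sum_(0 <= x < (maxn L p').+1 | (x < p'.+1)%N) F x).
  rewrite [RHS](big_cat_nat (n := L.+1)) //=; last by lia.
  rewrite [X in _ + X]big_nat_cond [X in _ + X]big1 ?addr0 // => x.
  rewrite /F => xl; rewrite bin_small ?mul0n ?mul0r //; lia.
rewrite -[RHS](big_mkord xpredT F) [RHS](big_nat_widen _ _ (maxn L p').+1) //.
lia.
Qed.

End Occupation.

(** * Normal ordering *)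

Section KernelIdentity.
Variables (N : nat) (C : numClosedFieldType).
Local Notation occv := {ffun 'I_N -> nat}.

Let frac q p : C := \prod_(i < N) ((q i <= p i)%N%:R / ((p i - q i)`!)%:R).

(** For a fixed word [e] the four constraints decouple: those on [s], [s'] and [r] can be counted
    independently, and the last one follows from the balance of occupations. *)
Let inner k M l (h h' : Idx N k) (t t' : Idx N M) : (l <= k)%N -> (l <= M)%N ->
  oadd (occ h') (occ t') = oadd (occ h) (occ t) ->
  \sum_(e : Idx N (k - l)) \sum_(r : Idx N (M - l)) \sum_(s : Idx N l)
     \sum_(s' : Idx N l)
     occK C h' e s' * occK C h e s * occK C t s' r * occK C t' s r =
  occw C k (occ h') * occw C k (occ h) * occw C M (occ t) * occw C M (occ t') *
  ((l`!)%:R * (l`!)%:R * ((M - l)`!)%:R) *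
  \sum_(e : Idx N (k - l)) frac (occ e) (occ h') * frac (occ e) (occ h) *
     frac (occ h') (oadd (occ t) (occ e)).
Proof.
move=> lk lM bal; rewrite mulr_sumr; apply: eq_bigr => e _.
transitivity (occw C k (occ h') * occw C k (occ h) * occw C M (occ t) *
  occw C M (occ t') *
  ((\sum_(r : Idx N (M - l)) (oadd (occ t) (occ e) == oadd (occ h') (occ r))%:R) *
   ((\sum_(s : Idx N l) (occ h == oadd (occ e) (occ s))%:R) *
   \sum_(s : Idx N l) (occ h' == oadd (occ e) (occ s))%:R))).
  rewrite mulr_suml mulr_sumr; apply: eq_bigr => r _.
  rewrite mulr_suml !mulr_sumr; apply: eq_bigr => s _.
  rewrite !mulr_sumr; apply: eq_bigr => s' _; rewrite /occK.
  case: eqP => [e1|_]; last by rewrite !(mul0r, mulr0).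
  case: eqP => [e2|_]; last by rewrite !(mul0r, mulr0).
  (* As [h'] is [e] plus [s'] in occupation, adding [e] to both sides removes [s'] from the
     constraint on [r]. *)
  have -> : (occ t == oadd (occ s') (occ r))
     = (oadd (occ t) (occ e) == oadd (occ h') (occ r)).
    apply/eqP/eqP=> /ffunP E; apply/ffunP=> i; have := E i;
      by rewrite e1 !oaddE; move: (occ t i); lia.
  case: eqP => [e3|_]; last by rewrite !(mul0r, mulr0).
  have -> : occ t' == oadd (occ s) (occ r).
    apply/eqP/ffunP=> i; move/ffunP/(_ i): bal; move/ffunP/(_ i): e3.
    rewrite e1 e2 !oaddE; move: (occ t i) (occ t' i) (occ s i) (occ s' i).
    by move: (occ r i) (occ e i) => *; lia.
  by rewrite /=; ring.
rewrite !(sum_occ_eq C (n := l)) ?sum_occ ?subnK // (sum_occ_eq C (n := M - l)).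
  by rewrite /frac; ring.
under eq_bigr do rewrite oaddE.
by rewrite big_split /= !sum_occ; lia.
Qed.

(** Normal ordering, entry by entry: the coefficient of one product of an entry of [phi] and a
    conjugate entry. Both sides vanish unless occupations balance. Otherwise the words [e] of all
    lengths [k - l] together run through the occupations in one box, which absorbs the sum over
    [l]. *)
Lemma occK_identity k M (h h' : Idx N k) (t t' : Idx N M) :
  'C(k + M, k)%:R * ((oadd (occ h') (occ t') == oadd (occ h) (occ t))%:R *
     occw C (k + M) (oadd (occ h) (occ t))) =
  \sum_(l < k.+1) ('C(k, l) * 'C(M, l))%:R *
    \sum_(e : Idx N (k - l)) \sum_(r : Idx N (M - l)) \sum_(s : Idx N l)
    \sum_(s' : Idx N l)
     occK C h' e s' * occK C h e s * occK C t s' r * occK C t' s r.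
Proof.
case: eqP => [bal|nb]; last first.
  rewrite mul0r mulr0 big1 // => l _; rewrite big1 ?mulr0 // => e _.
  rewrite big1 // => r _; rewrite big1 // => s _; rewrite big1 // => s' _.
  rewrite /occK; case: eqP => [e1|_]; last by rewrite !(mul0r, mulr0).
  case: eqP => [e2|_]; last by rewrite !(mul0r, mulr0).
  case: eqP => [e3|_]; last by rewrite !(mul0r, mulr0).
  case: eqP => [e4|_]; last by rewrite !(mul0r, mulr0).
  by case: nb; apply/ffunP=> i; rewrite !oaddE e1 e2 e3 e4 !oaddE; lia.
(* A given size [y] of [e] comes from the single value [l = k - y], which is admissible exactly when
   [l <= M]; the factors [frac] vanish on all other sizes. *)
have degsum y : (y <= k)%N -> (k <= M + y)%N ->
    \sum_(l < k.+1) (l <= M)%N%:R * (y == k - l)%N%:R = 1 :> C.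
  move=> yk kM; have lk : (k - y < k.+1)%N by lia.
  rewrite (bigD1 (Ordinal lk)) //= big1 => [|l nl].
    have -> : (k - y <= M)%N by lia.
    by rewrite subKn // eqxx /= addr0 mulr1.
  case: eqP => [E|_]; last by rewrite mulr0.
  by case/eqP: nl; apply/val_inj; rewrite /= E subKn // -ltnS.
pose w := occw C k (occ h') * occw C k (occ h) * occw C M (occ t) * occw C M (occ t').
pose g (p : occv) : C := \prod_(i < N) ((p i)`!)%:R^-1 *
   (frac p (occ h') * frac p (occ h) * frac (occ h') (oadd (occ t) p)).
transitivity (w * ((k`!)%:R * (M`!)%:R) *
   \sum_(x : {ffun 'I_N -> 'I_k.+1}) g (ocast x)); last first.
  transitivity (w * ((k`!)%:R * (M`!)%:R) *
    \sum_(l < k.+1) (l <= M)%N%:R *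
      \sum_(x : {ffun 'I_N -> 'I_k.+1}) (\sum_i x i == k - l)%N%:R * g (ocast x)).
    congr (_ * _); under [RHS]eq_bigr do rewrite mulr_sumr.
    rewrite exchange_big /=; apply: eq_bigr => x _.
    under eq_bigr do rewrite mulrA; rewrite -mulr_suml.
    have [/forallP xh|] := boolP [forall i, x i <= occ h i]%N; last first.
      rewrite negb_forall => /existsP[i xi].
      rewrite /g [frac _ (occ h)](bigD1 i) //= [ocast x i]ffunE (negPf xi).
      by rewrite !(mul0r, mulr0).
    have [/forallP hx|] := boolP [forall i, occ h' i <= occ t i + x i]%N; last first.
      rewrite negb_forall => /existsP[i xi].
      rewrite /g [frac (occ h') _](bigD1 i) //= oaddE [ocast x i]ffunE (negPf xi).
      by rewrite !(mul0r, mulr0).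
    have xk : (\sum_i x i <= k)%N by rewrite -[leqRHS](sum_occ h) leq_sum.
    have kx : (k <= M + \sum_i x i)%N.
      by rewrite -[leqLHS](sum_occ h') -[in leqRHS](sum_occ t) -big_split leq_sum.
    by rewrite degsum // mul1r.
  rewrite mulr_sumr; apply: eq_bigr => l _.
  have lk : (l <= k)%N by rewrite -ltnS.
  case: leqP => lM; last by rewrite !mul0r mulr0 [X in (_ * X)%N]bin_small // muln0 mul0r.
  rewrite inner // (sum_word (fun p => frac p (occ h') * frac p (occ h) *
     frac (occ h') (oadd (occ t) p)) (leq_subr l k)) mul1r -/w.
  rewrite !mulr_sumr; apply: eq_bigr => x _.
  rewrite -(bin_fact lk) -(bin_fact lM) !natrM /g.
  have -> : \prod_i ((ocast x i)`!)%:R^-1 = \prod_i (x i)`!%:R^-1 :> C.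
    by apply: eq_bigr => i _; rewrite ffunE.
  by ring.
(* The summand is a product over modes, so the sum over the box is a product of single-mode sums. *)
have -> : \sum_(x : {ffun 'I_N -> 'I_k.+1}) g (ocast x) =
   \prod_(i < N) ((occ h i + occ t i)`!)%:R / (\prod_(i < N)
      ((occ h i)`!%:R * (occ h' i)`!%:R * (occ t i)`!%:R * (occ t' i)`!%:R)).
  rewrite -prodf_div.
  transitivity (\prod_(i < N) \sum_(x < k.+1) ((x`!)%:R^-1 *
     ((x <= occ h' i)%:R / ((occ h' i - x)`!)%:R) *
     ((x <= occ h i)%:R / ((occ h i - x)`!)%:R) *
     ((occ h' i <= occ t i + x)%:R / ((occ t i + x - occ h' i)`!)%:R)) : C).
    rewrite bigA_distr_bigA /=; apply: eq_bigr => x _.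
    rewrite /g /frac -!big_split /=; apply: eq_bigr => i _.
    by rewrite oaddE [ocast x i]ffunE !mulrA.
  apply: eq_bigr => i _; have hk : (occ h i <= k)%N.
    by rewrite -[leqRHS](sum_occ h) (bigD1 i) //= leq_addr.
  rewrite -(@vandermonde_mode C k (occ h i) (occ h' i) (occ t i) (occ t' i)) //.
    by rewrite -mulr_suml mulfK // !mulf_neq0 // natr_fact_neq0.
  by move/ffunP/(_ i): bal; rewrite !oaddE.
have pn n (x : Idx N n) : \prod_(i < N) ((occ x i)`!)%:R != 0 :> C.
  by apply/prodf_neq0 => i _; exact: natr_fact_neq0.
rewrite !big_split /= /w /occw !natr_prod.
rewrite -(@bin_fact (k + M) k) ?leq_addr // addKn !natrM.
have -> : \prod_i ((oadd (occ h) (occ t) i)`!)%:R =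
  \prod_i (occ h i + occ t i)`!%:R :> C by apply: eq_bigr => i _; rewrite oaddE.
move: (pn _ h) (pn _ h') (pn _ t) (pn _ t') (natr_fact_neq0 C k) (natr_fact_neq0 C M).
have : 'C(k + M, k)%:R != 0 :> C by rewrite pnatr_eq0 -lt0n bin_gt0 leq_addr.
set a := 'C(_, _)%:R; set b := \prod_i (occ h i)`!%:R.
set b' := \prod_i (occ h' i)`!%:R; set c := \prod_i (occ t i)`!%:R.
set c' := \prod_i (occ t' i)`!%:R; set u := (k`!)%:R; set v := (M`!)%:R.
set z := \prod_i _.
move=> a0 b0 b'0 c0 c'0 u0 v0; rewrite mul1r.
by field; rewrite a0 b0 b'0 c0 c'0 u0 v0.
Qed.

End KernelIdentity.

(** * Concatenation of words and the symmetrizer as a projector *)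

Section Words.
Variable N : nat.

Definition wcat k M (z : Idx N k * Idx N M) : Idx N (k + M) :=
  [ffun i => match split i with inl j => z.1 j | inr j => z.2 j end].

Lemma wcat_bij k M : bijective (@wcat k M).
Proof.
exists (fun x : Idx N (k + M) =>
  ([ffun i => x (lshift M i)], [ffun j => x (rshift k j)])).
  case=> h t; congr pair; apply/ffunP=> i; rewrite !ffunE.
    by rewrite (unsplitK (inl i)).
  by rewrite (unsplitK (inr i)).
move=> x; apply/ffunP=> i; rewrite ffunE /=.
by case: splitP => j e; rewrite ffunE; congr (x _); apply/val_inj.
Qed.

Lemma occ_wcat k M (z : Idx N k * Idx N M) :
  occ (wcat z) = oadd (occ z.1) (occ z.2).
Proof.
apply/ffunP=> i; rewrite !ffunE big_split_ord /=; congr (_ + _)%N.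
  by apply: eq_bigr => j _; rewrite ffunE (unsplitK (inl j)).
by apply: eq_bigr => j _; rewrite ffunE (unsplitK (inr j)).
Qed.

Variable V : nmodType.

Lemma sum_ix n (F : Idx N n -> V) : \sum_a F (ix a) = \sum_x F x.
Proof. by rewrite -big_enum_val. Qed.

Lemma sum_wcat k M (F : Idx N (k + M) -> V) :
  \sum_x F x = \sum_h \sum_t F (wcat (h, t)).
Proof.
rewrite (reindex (@wcat k M)) /=; last exact/onW_bij/wcat_bij.
by rewrite (pair_bigA _ (fun h t => F (wcat (h, t)))); apply: eq_bigr => -[].
Qed.

Lemma sum_occ_cat n k M (F : {ffun 'I_N -> nat} -> V) : (n = k + M)%N ->
  \sum_(h : Idx N k) \sum_(t : Idx N M) F (oadd (occ h) (occ t)) =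
  \sum_(a : Idx N n) F (occ a).
Proof.
move=> ->; rewrite (sum_wcat (fun a => F (occ a))).
by apply: eq_bigr => h _; apply: eq_bigr => t _; rewrite occ_wcat.
Qed.

End Words.

Section Symmetrizer.
Variables (N : nat) (C : numClosedFieldType).
Local Notation P := (symP C N).

Lemma occw_real n (p : {ffun 'I_N -> nat}) : (occw C n p)^* = occw C n p :> C.
Proof. exact/geC0_conj/ltW/(@occw_gt0 N C). Qed.

Lemma occK_real n k M (a : Idx N n) (h : Idx N k) (t : Idx N M) :
  (occK C a h t)^* = occK C a h t.
Proof. by rewrite rmorphM /= conjC_nat occw_real. Qed.

Lemma sum_occw n (p : {ffun 'I_N -> nat}) : (\sum_i p i = n)%N ->
  \sum_(a : Idx N n) (p == occ a)%:R * occw C n p = 1.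
Proof.
move=> pn; pose z : {ffun 'I_N -> nat} := [ffun=> 0%N].
transitivity (\sum_(a : Idx N n) (p == oadd z (occ a))%:R * occw C n p : C).
  by apply: eq_bigr => a _; congr ((_ == _)%:R * _); apply/ffunP=> i; rewrite !ffunE.
rewrite -mulr_suml sum_occ_eq; last first.
  by rewrite pn [X in (X + _)%N]big1 // => i _; rewrite ffunE.
have n0 := natr_fact_neq0 C n.
have p0 : \prod_i ((p i)`!)%:R != 0 :> C.
  by apply/prodf_neq0 => i _; exact: natr_fact_neq0.
rewrite (_ : \prod_i _ = (\prod_i ((p i)`!)%:R)^-1 :> C).
  by rewrite /occw natr_prod; field; rewrite n0 p0.
by rewrite -prodfV; apply: eq_bigr => i _; rewrite ffunE subn0 mul1r.
Qed.

Lemma sum_occK2 k M (h h' : Idx N k) (t t' : Idx N M) :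
  \sum_(a : Idx N (k + M)) occK C a h' t' * occK C a h t =
  (oadd (occ h') (occ t') == oadd (occ h) (occ t))%:R *
    occw C (k + M) (oadd (occ h) (occ t)).
Proof.
have s : (\sum_i oadd (occ h) (occ t) i = k + M)%N.
  by under eq_bigr do rewrite oaddE; rewrite big_split /= !sum_occ.
rewrite -[RHS]mulr1 -[X in _ = _ * X](sum_occw s) mulr_sumr; apply: eq_bigr => a _.
rewrite /occK; case: (eqVneq (occ a) (oadd (occ h) (occ t))) => [->|_].
  by rewrite [_ == oadd (occ h') _]eq_sym /=; ring.
by rewrite !(mul0r, mulr0).
Qed.

Lemma symP_sym n a b : P n a b = P n b a.
Proof. by rewrite !symPE eq_sym; case: eqP => [->|]; rewrite ?mul0r. Qed.

Lemma symP_conj n : (P n)^t* = P n.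
Proof.
apply/matrixP=> a b; rewrite mxE [in LHS]mxE symP_sym symPE.
by rewrite rmorphM /= conjC_nat occw_real.
Qed.

Lemma symP_occ n (x : 'cV[C]_(tdim N n)) :
  (forall a b, occ (ix a) = occ (ix b) -> x a 0 = x b 0) -> P n *m x = x.
Proof.
move=> xE; apply/matrixP=> a j; rewrite ord1 mxE.
transitivity (\sum_(b : 'I_(tdim N n))
  ((occ (ix a) == occ (ix b))%:R * occw C n (occ (ix a))) * x a 0).
  apply: eq_bigr => b _; rewrite symPE.
  by case: eqP => [/xE->|]; rewrite ?mul0r.
rewrite -mulr_suml (sum_ix (fun b : Idx N n => (occ (ix a) == occ b)%:R * occw C n (occ (ix a)))).
by rewrite sum_occw ?mul1r // sum_occ.
Qed.

Lemma symP_idem n : P n *m P n = P n.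
Proof.
apply/matrixP=> a b; have : P n *m col b (P n) = col b (P n).
  by apply: symP_occ => a1 a2 e; rewrite ![col _ _ _ _]mxE !symPE e.
rewrite (colE b (P n)) mulmxA -!colE => /matrixP/(_ a 0).
by rewrite [in X in X -> _]mxE [X in _ = X -> _]mxE.
Qed.

(** The dimension of the symmetric subspace for [n <= L]. It is counted in a box of side [L] so that
    all sizes [n] can be compared inside one finite type. *)
Definition symdim L n := #|[set x : {ffun 'I_N -> 'I_L.+1} | \sum_i x i == n]%N|.

Lemma symP_trace L n : (n <= L)%N -> \tr (P n) = (symdim L n)%:R.
Proof.
move=> nL; rewrite /mxtrace; under eq_bigr do rewrite symPE eqxx mul1r.
rewrite (sum_ix (fun a : Idx N n => occw C n (occ a))) (sum_word _ nL).
rewrite /symdim -sum1dep_card natr_sum [RHS]big_mkcond /=.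
apply: eq_bigr => x _; case: eqP => _; last by rewrite !mul0r.
rewrite /occw natr_prod.
rewrite (_ : \prod_i ((ocast x i)`!)%:R = \prod_i ((x i)`!)%:R); last first.
  by apply: eq_bigr => i _; rewrite ffunE.
rewrite prodfV; have := natr_fact_neq0 C n.
have : \prod_i ((x i)`!)%:R != 0 :> C.
  by apply/prodf_neq0 => i _; exact: natr_fact_neq0.
by move=> p0 n0; rewrite /= mul1r; field; rewrite n0 p0.
Qed.

Lemma symP_rank L n : (n <= L)%N -> \rank (P n) = symdim L n.
Proof.
move=> nL; apply/eqP; rewrite -(eqr_nat C).
by rewrite mxrank_projector ?symP_idem ?symP_conj // (symP_trace nL).
Qed.

Lemma symP_quad_le j n (V : 'M[C]_(j, tdim N n)) : V \is unitarymx ->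
  \tr (V *m P n *m V^t*) <= (minn j (\rank (P n)))%:R.
Proof.
move=> Vu; pose Q := schmidt (row_base (P n)).
have Qu : Q \is unitarymx := range_basis_unitary _.
have -> : \tr (V *m P n *m V^t*) = \tr (V *m (Q^t* *m Q) *m V^t*).
  by rewrite range_basisK ?symP_idem ?symP_conj.
have tE m p (X : 'M[C]_(m, p)) : X \is unitarymx -> \tr (X *m X^t*) = m%:R.
  by move/unitarymxP->; rewrite mxtrace1.
rewrite /minn; case: ifP => _.
  rewrite -(tE _ _ _ Vu); apply: le_trans (gram_contraction V Qu).
  by rewrite trmxC_mul trmxCK !mulmxA.
rewrite -(tE _ _ _ Qu); apply: le_trans (gram_contraction Q Vu).
by rewrite trmxC_mul trmxCK mulmxA -mulmxA mxtrace_mulC.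
Qed.

End Symmetrizer.

(** * Creation operators and the normal ordering formula *)

Section Creation.
Variables (N : nat) (C : numClosedFieldType).
Local Notation P := (symP C N).

(* [chi |-> P_n (chi (x) phi)], i.e. multiplication by [phi] in the symmetric
   algebra. *)
Definition creat n k M (phi : 'cV[C]_(tdim N M)) : 'M[C]_(tdim N n, tdim N k) :=
  \matrix_(a, h) \sum_t occK C (ix a) (ix h) (ix t) * phi t 0.

(* The slice of [P_M phi] at the word [r] in the last [M - l] slots; summing the
   corresponding projectors over [r] gives the [l]-particle reduced density
   matrix. *)
Definition reduced M l (phi : 'cV[C]_(tdim N M)) (r : Idx N (M - l)) :
    'cV[C]_(tdim N l) :=
  \col_s \sum_t occK C (ix t) (ix s) r * phi t 0.

(** The squared norm of [P_M phi]; [phi] itself is required to be neither symmetric nor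
    normalized. *)
Definition symnorm M (phi : 'cV[C]_(tdim N M)) : C := \tr (P M *m (phi *m phi^t*)).

Lemma symnormE M (phi : 'cV[C]_(tdim N M)) :
  symnorm phi = \sum_t \sum_t' P M t t' * (phi t' 0 * (phi t 0)^*).
Proof.
rewrite /symnorm /mxtrace; apply: eq_bigr => t _; rewrite mxE.
by apply: eq_bigr => t' _; rewrite !mxE big_ord1 !mxE.
Qed.

Lemma symnorm_ge0 M (phi : 'cV[C]_(tdim N M)) : 0 <= symnorm phi.
Proof.
have -> : symnorm phi = \tr (P M *m phi *m (P M *m phi)^t*).
  by rewrite trmxC_mul symP_conj mulmxA mxtrace_mulC !mulmxA symP_idem -mulmxA.
exact: mxtrace_gram_ge0.
Qed.

(** Trace preservation of the partial trace. Each slice is already symmetric, so its projector drops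
    out, and summing over [s] and [r] composes two symmetrizers into one. *)
Lemma symnorm_reduced M l (phi : 'cV[C]_(tdim N M)) : (l <= M)%N ->
  \sum_r symnorm (@reduced M l phi r) = symnorm phi.
Proof.
move=> lM; transitivity (\sum_r \tr (@reduced M l phi r *m (reduced phi r)^t*)).
  apply: eq_bigr => r _; rewrite /symnorm mulmxA symP_occ // => a b e.
  by rewrite !mxE; apply: eq_bigr => t _; rewrite /occK e.
transitivity (\sum_(t : 'I_(tdim N M)) \sum_(t' : 'I_(tdim N M))
   (\sum_(s : Idx N l) \sum_(r : Idx N (M - l)) occK C (ix t) s r * occK C (ix t') s r)
    * (phi t' 0 * (phi t 0)^*)).
  transitivity (\sum_(r : Idx N (M - l)) \sum_(s : 'I_(tdim N l)) \sum_(t : 'I_(tdim N M))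
      \sum_(t' : 'I_(tdim N M)) occK C (ix t) (ix s) r * occK C (ix t') (ix s) r *
        (phi t' 0 * (phi t 0)^*)).
    apply: eq_bigr => r _; apply: eq_bigr => s _; rewrite mxE big_ord1 !mxE.
    rewrite rmorph_sum mulr_sumr; apply: eq_bigr => t _.
    rewrite mulr_suml; apply: eq_bigr => t' _.
    by rewrite rmorphM /= occK_real; ring.
  rewrite exchange_big /=.
  under eq_bigr do rewrite exchange_big /=.
  rewrite exchange_big /=; apply: eq_bigr => t _.
  under eq_bigr do rewrite exchange_big /=.
  rewrite exchange_big /=; apply: eq_bigr => t' _.
  rewrite mulr_suml -sum_ix; apply: eq_bigr => s _.
  by rewrite mulr_suml.
rewrite symnormE; apply: eq_bigr => t _; apply: eq_bigr => t' _; congr (_ * _).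
rewrite symPE.
transitivity (\sum_(h : Idx N l) \sum_(t0 : Idx N (M - l))
  (occ (ix t) == oadd (occ h) (occ t0))%:R * occw C M (occ (ix t)) *
  ((occ (ix t) == occ (ix t'))%:R * occw C M (occ (ix t)))).
  apply: eq_bigr => s _; apply: eq_bigr => r _; rewrite /occK -!mulrA.
  case: eqP => [e|_]; last by rewrite !mul0r.
  rewrite -e [occ (ix t') == _]eq_sym.
  by case: eqP => [->|]; rewrite ?mul0r.
rewrite (sum_occ_cat (fun p => (occ (ix t) == p)%:R * occw C M (occ (ix t)) *
   ((occ (ix t) == occ (ix t'))%:R * occw C M (occ (ix t))))
    (esym (subnKC lM))).
by rewrite -mulr_suml sum_occw ?mul1r // sum_occ.
Qed.

(* Normal ordering of the antinormally ordered [B^* B]. *)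
Lemma creat_gram n k M (phi : 'cV[C]_(tdim N M)) : (n = k + M)%N ->
  let B := @creat n k M phi in
  'C(n, k)%:R *: (B^t* *m B) = \sum_(l < k.+1) ('C(k, l) * 'C(M, l))%:R *:
     \sum_(r : Idx N (M - l)) (creat k (k - l) (reduced phi r) *m
                              (creat k (k - l) (reduced phi r))^t*).
Proof.
move=> -> B; apply/matrixP=> h' h; rewrite mxE summxE.
transitivity (\sum_(t : 'I_(tdim N M)) \sum_(t' : 'I_(tdim N M))
  'C(k + M, k)%:R * ((oadd (occ (ix h')) (occ (ix t')) ==
      oadd (occ (ix h)) (occ (ix t)))%:R *
     occw C (k + M) (oadd (occ (ix h)) (occ (ix t)))) *
     (phi t 0 * (phi t' 0)^*)).
  transitivity ('C(k + M, k)%:R * \sum_(a : 'I_(tdim N (k + M)))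
     \sum_(t : 'I_(tdim N M)) \sum_(t' : 'I_(tdim N M))
     occK C (ix a) (ix h') (ix t') * occK C (ix a) (ix h) (ix t) *
       (phi t 0 * (phi t' 0)^*)).
    congr (_ * _); rewrite mxE; apply: eq_bigr => a _; rewrite !mxE.
    rewrite rmorph_sum mulr_sumr; apply: eq_bigr => t _.
    rewrite mulr_suml; apply: eq_bigr => t' _.
    by rewrite rmorphM /= occK_real; ring.
  rewrite exchange_big mulr_sumr; apply: eq_bigr => t _.
  rewrite exchange_big mulr_sumr; apply: eq_bigr => t' _ /=.
  rewrite -sum_occK2 -mulrA; congr (_ * _); rewrite mulr_suml.
  by rewrite (sum_ix (fun a : Idx N (k + M) => occK C a (ix h') (ix t') *
    occK C a (ix h) (ix t) * (phi t 0 * (phi t' 0)^*))).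
under eq_bigr => t _ do (under eq_bigr => t' _ do
  (rewrite occK_identity mulr_suml)).
under eq_bigr => t _ do rewrite exchange_big /=.
rewrite exchange_big /=; apply: eq_bigr => l _; rewrite mxE summxE.
under eq_bigr => t _ do (under eq_bigr => t' _ do rewrite -mulrA).
under eq_bigr => t _ do rewrite -mulr_sumr.
rewrite -mulr_sumr; congr (_ * _).
transitivity (\sum_(r : Idx N (M - l)) \sum_(e : Idx N (k - l))
   \sum_(s : Idx N l) \sum_(s' : Idx N l)
   \sum_(t : 'I_(tdim N M)) \sum_(t' : 'I_(tdim N M))
    occK C (ix h') e s' * occK C (ix h) e s * occK C (ix t) s' r *
    occK C (ix t') s r * (phi t 0 * (phi t' 0)^*)).
  under eq_bigr => t _ do (under eq_bigr => t' _ do (rewrite exchange_big /=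
    mulr_suml; under eq_bigr => r _ do (rewrite mulr_suml;
    under eq_bigr => e _ do (rewrite mulr_suml;
    under eq_bigr => s _ do (rewrite mulr_suml))))).
  under eq_bigr => t _ do rewrite exchange_big /=.
  rewrite exchange_big /=; apply: eq_bigr => r _.
  under eq_bigr => t _ do rewrite exchange_big /=.
  rewrite exchange_big /=; apply: eq_bigr => e _.
  under eq_bigr => t _ do rewrite exchange_big /=.
  rewrite exchange_big /=; apply: eq_bigr => s _.
  under eq_bigr => t _ do rewrite exchange_big /=.
  by rewrite exchange_big /=.
apply: eq_bigr => r _; rewrite mxE -sum_ix; apply: eq_bigr => e _; rewrite !mxE.
rewrite rmorph_sum mulr_sumr -sum_ix; apply: eq_bigr => s _.
rewrite mulr_suml -sum_ix; apply: eq_bigr => s' _; rewrite !mxE rmorphM /= occK_real.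
rewrite rmorph_sum mulr_sumr mulr_suml; apply: eq_bigr => t _.
rewrite mulr_sumr mulr_sumr; apply: eq_bigr => t' _.
rewrite rmorphM /= occK_real; ring.
Qed.

End Creation.

(** * Sums of the largest eigenvalues *)

Section Excitations.
Variables (N : nat) (i0 : 'I_N) (L : nat).
Local Notation box := {ffun 'I_N -> 'I_L.+1}.
Local Notation symdim := (symdim N L).

Let raise (x : box) : box := [ffun i => if i == i0 then inord (x i).+1 else x i].
Let lower (x : box) : box := [ffun i => if i == i0 then inord (x i).-1 else x i].

Let raiseE (x : box) i : (x i0 < L)%N -> raise x i = (x i + (i == i0))%N :> nat.
Proof.
move=> xL; rewrite ffunE; case: eqP => [->|_]; last by rewrite addn0.
by rewrite inordK // addn1.
Qed.

Lemma sum_raise (V : nmodType) n (F : nat -> V) : (n < L)%N ->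
  \sum_(x : box | (\sum_i x i == n.+1)%N && (x i0 != 0 :> nat)) F (x i0 : nat) =
  \sum_(x : box | (\sum_i x i == n)%N) F (x i0).+1.
Proof.
move=> nL; rewrite (reindex_onto raise lower) /=; last first.
  move=> x /andP[_ x0]; apply/ffunP=> i; apply/val_inj; rewrite !ffunE.
  case: eqP => [->|//]; rewrite /=; have := ltn_ord (x i0); move: (x i0 : nat) x0 => y y0 yL.
  have yK : (inord y.-1 : 'I_L.+1) = y.-1 :> nat by rewrite inordK //; lia.
  by rewrite inordK yK; lia.
have le0 (x : box) : (x i0 <= \sum_i x i)%N by rewrite (bigD1 i0) //= leq_addr.
have sraise (x : box) : (x i0 < L)%N -> (\sum_i raise x i = (\sum_i x i).+1)%N.
  move=> xL; under eq_bigr do rewrite raiseE //.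
  rewrite big_split /= -[RHS]addn1; congr (_ + _)%N.
  by rewrite (bigD1 i0) //= eqxx big1 // => i /negPf->.
have rK (x : box) : (x i0 < L)%N -> lower (raise x) = x.
  move=> xL; apply/ffunP=> i; rewrite ffunE; case: eqP => [->|ne].
    by apply/val_inj; rewrite /= raiseE // eqxx addn1 /= inordK.
  by rewrite ffunE; case: eqP.
apply: eq_big => [x|x /andP[/andP[_ x0] _]].
  case: (ltnP (x i0) L) => xL.
    rewrite sraise // rK // eqSS raiseE // eqxx addn1 /=.
    by rewrite eqxx !andbT.
  have xL' : x i0 = L :> nat by apply/eqP; rewrite eqn_leq xL -ltnS ltn_ord.
  (* At the edge of the box [inord] overflows to 0. Such an [x] is excluded on one side by the
     condition of a nonempty mode, on the other by [n < L]. *)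
  have -> : raise x i0 = 0%N :> nat.
    rewrite ffunE eqxx /inord xL' /insubd insubF ?ltnn //.
  rewrite andbF; apply/esym/negbTE/negP => /eqP E.
  by have := le0 x; rewrite E xL' leqNgt nL.
congr F; move: x0; rewrite ffunE eqxx.
case: (ltnP (x i0) L) => xL; first by rewrite inordK.
have xL' : x i0 = L :> nat by apply/eqP; rewrite eqn_leq xL -ltnS ltn_ord.
by rewrite /inord xL' /insubd insubF ?ltnn.
Qed.

Let flat n := #|[set x : box | (\sum_i x i == n)%N && (x i0 == 0 :> nat)]|.

Lemma symdimS n : (n < L)%N -> symdim n.+1 = (symdim n + flat n.+1)%N.
Proof.
move=> nL; rewrite /symdim /flat -!sum1dep_card.
rewrite (bigID (fun x : box => x i0 == 0 :> nat)) /= addnC; congr (_ + _)%N.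
exact: (sum_raise (fun=> 1%N)).
Qed.

Lemma symdim_mono m n : (m <= n)%N -> (n <= L)%N -> (symdim m <= symdim n)%N.
Proof.
elim: n => [|n IH]; first by rewrite leqn0 => /eqP->.
rewrite leq_eqVlt => /orP[/eqP-> //|mn nL].
by apply: (leq_trans (IH mn (ltnW nL))); rewrite symdimS // leq_addr.
Qed.

(* Order the occupation states of all sizes by the number of particles outside
   the mode [i0]: [exc p] is this number for the [p]-th state.  It depends neither
   on the size nor on [i0]; beyond the range of the box it is the junk value
   [L.+1]. *)
Definition exc p := find (fun k => p < symdim k)%N (iota 0 L.+1).

(** States with at most [k] particles outside [i0] are the [k]-particle states with further
    particles put into [i0]; this is why [symdim k] is the threshold, whatever the total size. *)
Lemma exc_le p k : (k <= L)%N -> (exc p <= k)%N = (p < symdim k)%N.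
Proof.
move=> kL; apply/idP/idP => [ek|pk].
  have eL : (exc p < size (iota 0 L.+1))%N by rewrite size_iota ltnS (leq_trans ek).
  have := eL; rewrite -has_find => /(nth_find 0%N).
  rewrite nth_iota; last by rewrite size_iota in eL.
  by move/leq_trans; apply; apply: symdim_mono.
rewrite leqNgt; apply/negP => /(before_find 0%N).
by rewrite nth_iota ?ltnS // pk.
Qed.

Lemma exc_leq2 p q : (p <= q)%N -> (exc p <= exc q)%N.
Proof.
move=> pq; case: (leqP (exc q) L) => qL.
  by rewrite exc_le // (leq_ltn_trans pq) // -exc_le.
apply: leq_trans qL; have := find_size (fun k => p < symdim k)%N (iota 0 L.+1).
by rewrite size_iota.
Qed.

Lemma symdim0 : symdim 0 = 1%N.
Proof.
rewrite /symdim (_ : [set x | _] = [set [ffun=> ord0]]) ?cards1 //.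
apply/setP=> x; rewrite !inE sum_nat_eq0; apply/forallP/eqP => [x0|-> i].
  by apply/ffunP=> i; apply/val_inj; rewrite ffunE; apply/eqP/(implyP (x0 i)).
by rewrite ffunE.
Qed.

(** Induction on [n]: states with [i0] empty have all [n.+1] particles outside and fill the block of
    indices from [symdim n] on; the others arise by adding a particle in [i0], which leaves the
    number outside unchanged. *)
Lemma sum_exc (V : nmodType) n (F : nat -> V) : (n <= L)%N ->
  \sum_(x : box | (\sum_i x i == n)%N) F (n - x i0)%N =
  \sum_(p < symdim n) F (exc p).
Proof.
elim: n => [|n IH] nL.
  have /cards1P[x xE] : #|[set x : box | (\sum_i x i == 0)%N]| == 1%N.
    exact/eqP/symdim0.
  rewrite (big_pred1 x) => [|y]; last by move/setP/(_ y): xE; rewrite !inE.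
  rewrite symdim0 big_ord1 sub0n; congr F; apply/esym/eqP.
  by rewrite -leqn0 exc_le // symdim0.
rewrite (bigID (fun x : box => x i0 == 0 :> nat)) /= addrC.
rewrite (sum_raise (fun y => F (n.+1 - y)%N)) //.
rewrite [X in X + _ = _](eq_bigr (fun x : box => F (n - x i0)%N)) => [|x _ //].
rewrite IH; last exact: ltnW.
rewrite -!(big_mkord xpredT (fun p => F (exc p))).
rewrite [RHS](big_cat_nat _ (symdim_mono (leqnSn n) nL)) //=; congr (_ + _).
transitivity (\sum_(symdim n <= p < symdim n.+1) F n.+1).
  rewrite sumr_const_nat symdimS // addKn -sumr_const /flat.
  rewrite [RHS]big_mkcond [LHS]big_mkcond; apply: eq_bigr => x _; rewrite !inE.
  by case: ifP => // /andP[_ /eqP->]; rewrite subn0.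
apply: eq_big_nat => p /andP[np pn]; congr F; apply/esym/eqP.
rewrite eqn_leq exc_le // pn /= ltnNge exc_le; last exact: ltnW.
by rewrite -leqNgt.
Qed.

End Excitations.

(* 'C(n, M) times the eigenvalue of [P_n (I (x) |u^M><u^M|) P_n] at an occupation
   state with [s] particles outside the mode [u]. *)
Definition cohw M n s : nat := if (s <= n)%N then 'C(n - s, M) else 0.

(** Vandermonde's convolution for $n-s=M+(k-s)$. For [s > k] both sides vanish, since fewer than [M]
    particles remain in the mode. *)
Lemma cohw_vandermonde k M s :
  cohw M (k + M) s = (\sum_(l < k.+1) 'C(M, l) * cohw l k s)%N.
Proof.
rewrite /cohw; case: leqP => sk; case: leqP => sk' //.
- rewrite (_ : k + M - s = M + (k - s))%N; last by lia.
  rewrite -bin_sub ?leq_addr // addKn -binomial.Vandermonde.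
  rewrite (big_ord_widen k.+1 (fun l => 'C(M, l) * 'C(k - s, k - s - l)))%N; last by lia.
  rewrite big_mkcond; apply: eq_bigr => l _; rewrite ltnS.
  by case: leqP => lk; rewrite ?bin_sub // [X in (_ * X)%N]bin_small ?muln0.
- by rewrite bin_small ?big1 // => [l _|]; [rewrite muln0 | lia].
- lia.
- by rewrite big1 // => l _; rewrite muln0.
Qed.

(** * The Ky Fan bound and the trace by recursion on the number of particles *)

Section TopBound.
Variables (N : nat) (C : numClosedFieldType) (i0 : 'I_N) (L : nat).
Local Notation P := (symP C N).
Local Notation symdim := (symdim N L).
Local Notation exc := (exc N L).

Lemma word0_occ (x : Idx N 0) (p : {ffun 'I_N -> nat}) : oadd p (occ x) = p.
Proof. by apply/ffunP=> i; rewrite !ffunE big_ord0 addn0. Qed.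

Lemma creat_vacuum n (phi : 'cV[C]_(tdim N 0)) :
  creat n n phi *m (creat n n phi)^t* = symnorm phi *: P n.
Proof.
have [x0 x0E] : exists x0 : 'I_(tdim N 0), forall x, x = x0.
  have /fintype1P[x xE] : #|{: Idx N 0}| == 1%N.
    by rewrite card_ffun !card_ord expn0.
  exists (rk x) => y; apply: enum_val_inj; rewrite [LHS]xE [RHS]xE //.
have cE : creat n n phi = phi x0 0 *: P n.
  apply/matrixP=> a h; rewrite !mxE (bigD1 x0) //= big1 ?addr0 => [|x]; last first.
    by rewrite (x0E x) eqxx.
  by rewrite /occK word0_occ -symPE !mxE mulrC.
have nE : symnorm phi = phi x0 0 * (phi x0 0)^*.
  rewrite symnormE (bigD1 x0) //= (bigD1 x0) //= !big1 ?addr0 => [|y|y].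
  - rewrite symPE eqxx mul1r /occw big1 => [|i _]; first by rewrite divr1 mul1r.
    by rewrite ffunE big_ord0.
  - by rewrite (x0E y) eqxx.
  - by rewrite (x0E y) eqxx.
rewrite cE nE linearZ /= map_mxZ symP_conj -scalemxAl -scalemxAr symP_idem.
by rewrite scalerA.
Qed.

Let sum_ltn j d : (\sum_(p < j) (p < d) = minn j d)%N.
Proof. by elim: j => [|j IH]; rewrite ?big_ord0 ?big_ord_recr /= ?IH; lia. Qed.

Let creat_gram_trace n k M (phi : 'cV[C]_(tdim N M)) j (W : 'M[C]_(j, tdim N k)) :
  (n = k + M)%N -> let B := @creat N C n k M phi in
  'C(n, M)%:R * \tr (W *m (B^t* *m B) *m W^t*) =
  \sum_(l < k.+1) ('C(M, l))%:R * \sum_(r : Idx N (M - l))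
     ('C(k, l)%:R * \tr (W *m (creat k (k - l) (reduced phi r) *m
        (creat k (k - l) (reduced phi r))^t*) *m W^t*)).
Proof.
move=> nE B; rewrite {1}nE -bin_sub ?leq_addl // addnK -nE.
rewrite -mxtraceZ scalemxAl scalemxAr creat_gram // mulmx_sumr mulmx_suml.
rewrite raddf_sum /=; apply: eq_bigr => l _.
rewrite -scalemxAr -scalemxAl mxtraceZ mulnC natrM -mulrA; congr (_ * _).
by rewrite mulmx_sumr mulmx_suml raddf_sum mulr_sumr.
Qed.

(** The hypothesis for [k < n] is applied to each slice with parameters [(k, k - l, l)]. The bound
    is linear in [symnorm], so the slices add up by [symnorm_reduced], and since [exc] does not
    depend on the size, the weights at each index [p] combine by [cohw_vandermonde]. *)
Lemma creat_top n k M (phi : 'cV[C]_(tdim N M)) j (V : 'M[C]_(j, tdim N n)) :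
  (n = k + M)%N -> (n <= L)%N -> V \is unitarymx ->
  let B := @creat N C n k M phi in
  'C(n, M)%:R * \tr (V *m (B *m B^t*) *m V^t*) <=
    symnorm phi * \sum_(p < j) (cohw M n (exc p))%:R.
Proof.
have [b nb] := ubnP n; elim: b n k M phi j V nb => // b IH n k M phi j V.
rewrite ltnS => nb nE nL Vu; cbv zeta; set B := creat n k phi.
have [M0|Mpos] := posnP M.
  subst M; rewrite addn0 in nE; subst n; rewrite bin0 mul1r creat_vacuum.
  rewrite -scalemxAr -scalemxAl mxtraceZ ler_wpM2l ?symnorm_ge0 //.
  apply: le_trans (symP_quad_le Vu) _; rewrite -natr_sum ler_nat (symP_rank N C nL).
  rewrite -sum_ltn leq_sum // => p _.
  by rewrite /cohw exc_le // bin0; case: ifP.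
have [r rj [W Wu WB]] := kyfan_exchange B Vu.
apply: (@le_trans _ _ ('C(n, M)%:R * \tr (W *m (B^t* *m B) *m W^t*))).
  by rewrite ler_wpM2l ?ler0n.
rewrite creat_gram_trace //.
(* The exchanged frame may have fewer than [j] rows; the terms restored here are nonnegative. *)
apply: (@le_trans _ _ (symnorm phi * \sum_(p < r) (cohw M n (exc p))%:R)); last first.
  rewrite ler_wpM2l ?symnorm_ge0 // -(subnKC rj) big_split_ord /=.
  by rewrite lerDl sumr_ge0 // => p _; rewrite ler0n.
apply: (@le_trans _ _ (\sum_(l < k.+1) ('C(M, l))%:R *
    (symnorm phi * \sum_(p < r) (cohw l k (exc p))%:R))).
  apply: ler_sum => l _; have lk : (l <= k)%N by rewrite -ltnS.
  case: (leqP l M) => lM; last by rewrite bin_small // !mul0r.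
  rewrite ler_wpM2l ?ler0n // -(symnorm_reduced phi lM) mulr_suml.
  apply: ler_sum => q _; apply: IH => //; rewrite ?subnK //; lia.
rewrite le_eqVlt; apply/orP; left; apply/eqP.
under eq_bigr do rewrite mulrCA mulr_sumr; rewrite -mulr_sumr; congr (_ * _).
rewrite exchange_big /=; apply: eq_bigr => p _.
by rewrite nE cohw_vandermonde natr_sum; apply: eq_bigr => l _; rewrite natrM.
Qed.

(** The same recursion with equalities, because [B B^*] and [B^* B] have the same trace. It supplies
    the equal totals required for majorization without evaluating them. *)
Lemma creat_trace n k M (phi : 'cV[C]_(tdim N M)) :
  (n = k + M)%N -> (n <= L)%N -> let B := @creat N C n k M phi in
  'C(n, M)%:R * \tr (B *m B^t*) =
    symnorm phi * \sum_(p < symdim n) (cohw M n (exc p))%:R.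
Proof.
have [b nb] := ubnP n; elim: b n k M phi nb => // b IH n k M phi.
rewrite ltnS => nb nE nL B; have [M0|Mpos] := posnP M.
  subst M; rewrite addn0 in nE; subst n; rewrite bin0 mul1r /B creat_vacuum.
  rewrite mxtraceZ (symP_trace N C nL); congr (_ * _).
  rewrite (eq_bigr (fun=> 1)) => [|p _]; first by rewrite sumr_const card_ord.
  by rewrite /cohw exc_le // bin0 ltn_ord.
have kn : (k <= n)%N by rewrite nE leq_addr.
have := creat_gram_trace phi 1%:M nE; cbv zeta.
rewrite mul1mx trmx1 map_mx1 mulmx1 mxtrace_mulC -/B => ->.
transitivity (\sum_(l < k.+1) ('C(M, l))%:R *
    (symnorm phi * \sum_(p < symdim k) (cohw l k (exc p))%:R)).
  apply: eq_bigr => l _; have lk : (l <= k)%N by rewrite -ltnS.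
  case: (leqP l M) => lM; last by rewrite bin_small // !mul0r.
  congr (_ * _); rewrite -(symnorm_reduced phi lM) mulr_suml.
  apply: eq_bigr => q _; rewrite mul1mx mulmx1; apply: IH; rewrite ?subnK //; lia.
under eq_bigr do rewrite mulrCA mulr_sumr; rewrite -mulr_sumr; congr (_ * _).
rewrite exchange_big /= -(subnKC (symdim_mono i0 kn nL)) big_split_ord /=.
(* From index [symdim k] on, more than [k] of the [n] particles lie outside the mode, hence fewer
   than [M] inside, and the weight is 0. *)
rewrite [X in _ = _ + X]big1 ?addr0 => [|p _].
  apply: eq_bigr => p _.
  by rewrite nE cohw_vandermonde natr_sum; apply: eq_bigr => l _; rewrite natrM.
rewrite /cohw; case: ifP => // en; rewrite bin_small //.
have : (k < exc (symdim k + p))%N.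
  by rewrite ltnNge exc_le ?(leq_trans kn) // -leqNgt leq_addr.
by move: en; move: (exc _) => e; lia.
Qed.

End TopBound.

(** * Tensor powers *)

Section Tensors.
Variables (N : nat) (C : numClosedFieldType).
Local Notation P := (symP C N).

Definition whead k M (x : Idx N (k + M)) : Idx N k := [ffun i => x (lshift M i)].
Definition wtail k M (x : Idx N (k + M)) : Idx N M := [ffun j => x (rshift k j)].

Lemma whead_wcat k M (z : Idx N k * Idx N M) : whead (wcat z) = z.1.
Proof. by apply/ffunP=> i; rewrite !ffunE (unsplitK (inl i)). Qed.

Lemma wtail_wcat k M (z : Idx N k * Idx N M) : wtail (wcat z) = z.2.
Proof. by apply/ffunP=> i; rewrite !ffunE (unsplitK (inr i)). Qed.

Lemma ixK n : cancel (@ix N n) (@rk N n). Proof. exact: enum_valK. Qed.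
Lemma rkK n : cancel (@rk N n) (@ix N n). Proof. exact: enum_rankK. Qed.

(* [chi |-> chi (x) phi] *)
Definition tensl k M (phi : 'cV[C]_(tdim N M)) : 'M[C]_(tdim N (k + M), tdim N k) :=
  \matrix_(a, h) ((whead (ix a) == ix h)%:R * phi (rk (wtail (ix a))) 0).

Lemma idtens_ketbra k M (phi : 'cV[C]_(tdim N M)) :
  idtens k (ketbra phi) = tensl k phi *m (tensl k phi)^t*.
Proof.
apply/matrixP=> a b; rewrite !mxE big_ord1 !mxE.
rewrite (bigD1 (rk (whead (ix a)))) //= !mxE rkK eqxx mul1r big1 => [|h nh].
  by rewrite addr0 rmorphM /= conjC_nat eq_sym mulrCA.
rewrite !mxE (_ : (whead (ix a) == ix h) = false) ?mul0r //.
by apply: contraNF nh => /eqP->; rewrite ixK.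
Qed.

Lemma symP_tensl k M (phi : 'cV[C]_(tdim N M)) :
  P (k + M) *m tensl k phi = creat (k + M) k phi.
Proof.
apply/matrixP=> a h; rewrite !mxE.
transitivity (\sum_(x : Idx N (k + M)) (occ (ix a) == occ x)%:R *
   occw C (k + M) (occ (ix a)) *
   ((whead x == ix h)%:R * phi (rk (wtail x)) 0)).
  by rewrite -sum_ix; apply: eq_bigr => b _; rewrite symPE !mxE.
rewrite sum_wcat (bigD1 (ix h)) //= [X in _ + X]big1 => [|h' nh]; last first.
  by apply: big1 => t _; rewrite whead_wcat (negPf nh) mul0r mulr0.
rewrite addr0 -sum_ix; apply: eq_bigr => t _.
by rewrite whead_wcat wtail_wcat occ_wcat eqxx mul1r ixK.
Qed.

Lemma sym_idtens_ketbra k M (phi : 'cV[C]_(tdim N M)) :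
  P (k + M) *m idtens k (ketbra phi) *m P (k + M) =
  creat (k + M) k phi *m (creat (k + M) k phi)^t*.
Proof.
by rewrite -symP_tensl trmxC_mul symP_conj idtens_ketbra !mulmxA.
Qed.

Lemma idtens_sum k M (I : finType) (r : I -> C) (A : I -> 'M[C]_(tdim N M)) :
  idtens k (\sum_i r i *: A i) = \sum_i r i *: idtens k (A i).
Proof.
apply/matrixP=> a b; rewrite mxE !summxE mulr_sumr.
by apply: eq_bigr => i _; rewrite !mxE; ring.
Qed.

Definition tpow n (U : 'M[C]_N) : 'M[C]_(tdim N n) :=
  \matrix_(a, b) \prod_(i < n) U (ix a i) (ix b i).

Lemma sum_prod_word n (F : 'I_n -> 'I_N -> C) :
  \sum_(x : Idx N n) \prod_i F i (x i) = \prod_i \sum_j F i j.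
Proof. by rewrite bigA_distr_bigA. Qed.

Lemma tpow_mul n U V : tpow n U *m tpow n V = tpow n (U *m V).
Proof.
apply/matrixP=> a b; rewrite !mxE.
under [RHS]eq_bigr do rewrite mxE.
rewrite -sum_prod_word -sum_ix; apply: eq_bigr => c _.
by rewrite !mxE -big_split.
Qed.

Lemma tpow_conj n U : (tpow n U)^t* = tpow n (U^t*).
Proof.
apply/matrixP=> a b; rewrite !mxE rmorph_prod.
by apply: eq_bigr => i _; rewrite !mxE.
Qed.

Lemma tpow1 n : tpow n 1%:M = 1%:M.
Proof.
apply/matrixP=> a b; rewrite !mxE; case: eqVneq => [->|ab].
  by rewrite big1 // => i _; rewrite mxE eqxx.
have [i ne] : exists i, ix a i != ix b i.
  apply/existsP; rewrite -negb_forall; apply: contra ab => /forallP e.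
  by apply/eqP/enum_val_inj/ffunP => i; apply/eqP/e.
by rewrite (bigD1 i) //= mxE (negPf ne) mul0r.
Qed.

Lemma tpow_unitary n U : U \is unitarymx -> tpow n U \is unitarymx.
Proof.
by move=> /unitarymxP UU; apply/unitarymxP; rewrite tpow_conj tpow_mul UU tpow1.
Qed.

Lemma tpow_tensorpow n U u : tpow n U *m tensorpow n u = tensorpow n (U *m u).
Proof.
apply/matrixP=> a b; rewrite !mxE.
under [RHS]eq_bigr do rewrite mxE.
rewrite -sum_prod_word -sum_ix; apply: eq_bigr => c _.
by rewrite !mxE -big_split.
Qed.

Lemma tensorpow_dot n (u v : 'cV[C]_N) :
  ((tensorpow n u)^t* *m tensorpow n v) 0 0 = ((u^t* *m v) 0 0) ^+ n.
Proof.
rewrite mxE; transitivity (\sum_(x : Idx N n) \prod_i ((u (x i) 0)^* * v (x i) 0)).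
  rewrite -sum_ix; apply: eq_bigr => a _.
  by rewrite !mxE rmorph_prod -big_split.
rewrite (sum_prod_word (fun _ j => (u j 0)^* * v j 0)) prodr_const card_ord.
by congr (_ ^+ _); rewrite mxE; apply: eq_bigr => j _; rewrite !mxE.
Qed.

Lemma symP_perm n a b : P n a b =
  (\sum_(s : 'S_n) ([ffun i => ix b (s i)] == ix a :> Idx N n)%:R) / (n`!)%:R.
Proof.
rewrite mxE -sum1dep_card natr_sum big_mkcond; congr (_ / _).
by apply: eq_bigr => s _; case: ifP.
Qed.

Lemma tpow_symP n U : tpow n U *m P n = P n *m tpow n U.
Proof.
pose R (x y : Idx N n) := \prod_(i < n) U (x i) (y i).
apply/matrixP=> a b; rewrite !mxE.
transitivity (\sum_(s : 'S_n) R (ix a) [ffun i => ix b (s i)] / (n`!)%:R).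
  under eq_bigr => c _ do rewrite symP_perm mulrA mulr_sumr mulr_suml.
  rewrite exchange_big /=; apply: eq_bigr => s _.
  rewrite (bigD1 (rk [ffun i => ix b (s i)])) //= rkK eqxx mulr1 mxE rkK.
  rewrite [X in _ + X]big1 ?addr0 // => c nc.
  rewrite (_ : (_ == _) = false) ?mulr0 ?mul0r //.
  by apply: contraNF nc => /eqP->; rewrite ixK.
transitivity (\sum_(s : 'S_n) R [ffun i => ix a (s i)] (ix b) / (n`!)%:R).
  rewrite (reindex_inj invg_inj); apply: eq_bigr => s _; congr (_ / _).
  rewrite /R (reindex_inj (@perm_inj _ s)); apply: eq_bigr => i _.
  by rewrite !ffunE permK.
symmetry; under eq_bigr => c _ do rewrite symP_sym symP_perm -mulrA mulr_suml.
rewrite exchange_big /=; apply: eq_bigr => s _.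
rewrite (bigD1 (rk [ffun i => ix a (s i)])) //= rkK eqxx mul1r mxE rkK.
rewrite [X in _ + X]big1 ?addr0 => [|c nc]; first by rewrite mulrC.
rewrite (_ : (_ == _) = false) ?mul0r //.
by apply: contraNF nc => /eqP->; rewrite ixK.
Qed.

(** Covariance under one-particle unitaries, which allows a coherent state to be rotated onto a
    basis mode. *)
Lemma tpow_tensl k M U (phi : 'cV[C]_(tdim N M)) :
  tpow (k + M) U *m tensl k phi = tensl k (tpow M U *m phi) *m tpow k U.
Proof.
apply/matrixP=> a h; rewrite !mxE.
transitivity (\sum_(x : Idx N (k + M)) (\prod_i U (ix a i) (x i)) *
   ((whead x == ix h)%:R * phi (rk (wtail x)) 0)).
  by rewrite -sum_ix; apply: eq_bigr => b _; rewrite !mxE.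
rewrite sum_wcat (bigD1 (ix h)) //= [X in _ + X]big1 => [|h' nh]; last first.
  by apply: big1 => t _; rewrite whead_wcat (negPf nh) mul0r mulr0.
rewrite (bigD1 (rk (whead (ix a)))) //= [X in _ = _ + X]big1 => [|h' nh]; last first.
  rewrite mxE (_ : (_ == _) = false) ?mul0r //.
  by apply: contraNF nh => /eqP->; rewrite ixK.
rewrite !addr0 !mxE !rkK eqxx mul1r mulr_suml -sum_ix; apply: eq_bigr => t _.
rewrite whead_wcat wtail_wcat eqxx mul1r ixK big_split_ord /= !mxE rkK.
set X := \prod_(i < k) U _ (wcat _ _); set Y := \prod_(i < M) U _ (wcat _ _).
have -> : X = \prod_i U (whead (ix a) i) (ix h i).
  by apply: eq_bigr => i _; rewrite !ffunE (unsplitK (inl i)).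
suff -> : Y = \prod_i U (wtail (ix a) i) (ix t i) by ring.
by apply: eq_bigr => i _; rewrite !ffunE (unsplitK (inr i)).
Qed.

End Tensors.

(** * Coherent states and extremal vectors *)

Section OccupationVectors.
Variables (N : nat) (C : numClosedFieldType).
Local Notation P := (symP C N).
Local Notation occv := {ffun 'I_N -> nat}.

(** The occupation state, left unnormalized: the weight [occw] replaces the square roots of a
    normalized one. *)
Definition occvec n (m : occv) : 'cV[C]_(tdim N n) := \col_a (occ (ix a) == m)%:R.

Lemma symP_occvec n (m : occv) : P n *m occvec n m = occvec n m.
Proof. by apply: symP_occ => a b e; rewrite !mxE e. Qed.

Lemma occvec_norm n (m : occv) : (\sum_i m i = n)%N ->
  occw C n m * ((occvec n m)^t* *m occvec n m) 0 0 = 1.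
Proof.
move=> mn; rewrite -(sum_occw C mn) mxE mulr_sumr -sum_ix; apply: eq_bigr => a _.
by rewrite !mxE conjC_nat -natrM mulnb andbb mulrC eq_sym.
Qed.

Lemma sum_occvec n L : (n <= L)%N ->
  \sum_(x : {ffun 'I_N -> 'I_L.+1} | (\sum_i x i == n)%N)
     occw C n (ocast x) *: (occvec n (ocast x) *m (occvec n (ocast x))^t*) = P n.
Proof.
move=> nL; apply/matrixP=> a b; rewrite summxE symPE.
have bnd i : (occ (ix a) i < L.+1)%N.
  by rewrite ltnS (leq_trans _ nL) // -[leqRHS](sum_occ (ix a)) (bigD1 i) //= leq_addr.
pose x := [ffun i => Ordinal (bnd i)].
have xa : ocast x = occ (ix a) by apply/ffunP=> i; rewrite !ffunE.
have sx : (\sum_i x i == n)%N.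
  by rewrite -[X in _ == X](sum_occ (ix a)) -xa; apply/eqP/eq_bigr => i _; rewrite [RHS]ffunE.
rewrite (bigD1 x) //= big1 ?addr0 => [|y /andP[_ ny]].
  by rewrite !mxE big_ord1 !mxE xa eqxx conjC_nat mul1r mulrC eq_sym.
rewrite !mxE big_ord1 !mxE (_ : (_ == ocast y) = false) ?mul0r ?mulr0 //.
apply: contraNF ny => /eqP E; apply/eqP/ffunP=> i; apply/val_inj.
by move: E; rewrite -xa => /ffunP/(_ i); rewrite [LHS]ffunE [RHS]ffunE => ->.
Qed.

(** The unitary diagonalizes [|u><u|], so the image [w] of [u] has a diagonal [w w^*] and therefore
    a single nonzero coordinate. Its phase is left undetermined. *)
Lemma unitary_to_axis (u : 'cV[C]_N) : unit_vector u ->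
  exists U : 'M[C]_N, exists2 i : 'I_N, U \is unitarymx &
    (forall j, j != i -> (U *m u) j 0 = 0) /\ `|(U *m u) i 0| = 1.
Proof.
move=> uu; pose U := spectralmx (ketbra u).
have Uu : U \is unitarymx := spectral_unitarymx _.
exists U; set w := U *m u.
have wE i j : w i 0 * (w j 0)^* = spectral_diag (ketbra u) 0 i *+ (i == j).
  have H : (ketbra u)^t* = ketbra u by rewrite trmxC_mul trmxCK.
  have := hermitian_spectral H; rewrite -/U /ketbra mulmxA -mulmxA -trmxC_mul -/w.
  by move=> /matrixP/(_ i j); rewrite !mxE big_ord1 !mxE.
have ww : \sum_i `|w i 0| ^+ 2 = 1.
  have <- : (w^t* *m w) 0 0 = 1.
    rewrite trmxC_mul mulmxA -[u^t* *m _ *m _]mulmxA.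
    by rewrite (mulmx1C (unitarymxP Uu)) mulmx1.
  by rewrite mxE; apply: eq_bigr => i _; rewrite !mxE normCKC.
have [i wi] : exists i, w i 0 != 0.
  apply/existsP; rewrite -negb_forall; apply/negP => /forallP w0.
  move/eqP: ww; rewrite big1 ?(eq_sym 0) ?oner_eq0 // => i _.
  by rewrite (eqP (w0 i)) normr0 expr0n.
exists i => //.
have w0 j : j != i -> w j 0 = 0.
  move=> ji; apply/eqP; have := wE j i; rewrite (negPf ji) mulr0n => /eqP.
  by rewrite mulf_eq0 conjC_eq0 (negPf wi) orbF.
split=> //; apply/eqP; rewrite -sqrp_eq1 // -ww (bigD1 i) //= big1 ?addr0 //.
by move=> j /w0 ->; rewrite normr0 expr0n.
Qed.

(** After rotation [u] occupies the mode [i1] alone, so the entry at [h] is a phase if [m] is [h]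
    plus [M] particles in [i1], and 0 otherwise. What remains is a multinomial count of such words
    [h]. *)
Lemma coherent_occupation k M (m : occv) U (i1 : 'I_N) (u : 'cV[C]_N) :
  U \is unitarymx -> (forall j, j != i1 -> (U *m u) j 0 = 0) ->
  `|(U *m u) i1 0| = 1 -> (\sum_i m i = k + M)%N ->
  let B := P (k + M) *m tensl k (tensorpow M u) in
  let z := (occvec (k + M) m)^t* *m tpow (k + M) U *m B in
  occw C (k + M) m * (z *m z^t*) 0 0 = 'C(m i1, M)%:R / 'C(k + M, M)%:R.
Proof.
move=> Uu w0 w1 mn B z; set w := U *m u in w0 w1.
have zE : z = (occvec (k + M) m)^t* *m tensl k (tensorpow M w) *m tpow k U.
  rewrite /z /B mulmxA -[_ *m tpow _ _ *m P _]mulmxA tpow_symP.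
  rewrite mulmxA -{1}(symP_conj N C (k + M)) -trmxC_mul symP_occvec.
  by rewrite -mulmxA tpow_tensl tpow_tensorpow mulmxA.
have -> : z *m z^t* = (occvec (k + M) m)^t* *m tensl k (tensorpow M w) *m
   ((occvec (k + M) m)^t* *m tensl k (tensorpow M w))^t*.
  rewrite zE [in LHS]trmxC_mul mulmxA -[_ *m tpow k U *m _]mulmxA.
  by rewrite (unitarymxP (tpow_unitary k Uu)) mulmx1.
pose d : occv := [ffun i => M * (i == i1)]%N.
have dE : occ ([ffun=> i1] : Idx N M) = d.
  apply/ffunP=> i; rewrite !ffunE; under eq_bigr do rewrite ffunE.
  by rewrite sum_nat_const card_ord eq_sym.
have rowE h : ((occvec (k + M) m)^t* *m tensl k (tensorpow M w)) 0 h =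
    (m == oadd d (occ (ix h)))%:R * w i1 0 ^+ M.
  rewrite mxE; transitivity (\sum_(x : Idx N (k + M)) (occ x == m)%:R *
      ((whead x == ix h)%:R * \prod_(i < M) w (wtail x i) 0)).
    by rewrite -sum_ix; apply: eq_bigr => a _; rewrite !mxE conjC_nat rkK.
  rewrite sum_wcat (bigD1 (ix h)) //= [X in _ + X]big1 => [|h' nh]; last first.
    by apply: big1 => t _; rewrite whead_wcat (negPf nh) mul0r mulr0.
  rewrite addr0 (bigD1 [ffun=> i1]) //= [X in _ + X]big1 => [|t nt]; last first.
    have [i ti] : exists i, t i != i1.
      apply/existsP; rewrite -negb_forall; apply: contra nt => /forallP e.
      by apply/eqP/ffunP => i; rewrite ffunE; apply/eqP/e.
    by rewrite wtail_wcat (bigD1 i) //= w0 // mul0r !mulr0.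
  rewrite addr0 whead_wcat eqxx mul1r occ_wcat dE wtail_wcat; congr (_%:R * _).
    by congr nat_of_bool; rewrite eq_sym; congr (_ == _); apply/ffunP=> i; rewrite !ffunE addnC.
  by under eq_bigr do rewrite ffunE; rewrite prodr_const card_ord.
have sd : (\sum_i m i = \sum_i d i + k)%N by rewrite -dE sum_occ mn addnC.
transitivity (occw C (k + M) m * \sum_(s : Idx N k) (m == oadd d (occ s))%:R).
  congr (_ * _); rewrite mxE -sum_ix; apply: eq_bigr => h _.
  rewrite [X in _ * X]mxE [X in _ * (_ X)]mxE rowE -normCK normrM normrX w1 expr1n mulr1.
  by rewrite normr_nat -natrX; case: eqP.
rewrite (sum_occ_eq C sd) (bigD1 i1) //= /occw natr_prod (bigD1 i1) //=.
have -> : \prod_(i < N | i != i1) ((d i <= m i)%:R / ((m i - d i)`!)%:R) =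
  (\prod_(i < N | i != i1) ((m i)`!)%:R)^-1 :> C.
  rewrite -prodfV; apply: eq_bigr => i ne.
  by rewrite ffunE (negPf ne) muln0 subn0 leq0n mul1r.
rewrite ffunE eqxx muln1.
have pn : \prod_(i < N | i != i1) ((m i)`!)%:R != 0 :> C.
  by apply/prodf_neq0 => i _; exact: natr_fact_neq0.
have CE a b : (b <= a)%N -> 'C(a, b)%:R = (a`!)%:R / ((b`!)%:R * ((a - b)`!)%:R) :> C.
  by move=> ba; rewrite -(bin_fact ba) !natrM mulfK // mulf_neq0 // natr_fact_neq0.
rewrite [X in _ = _ / X]CE ?leq_addl // addnK.
case: leqP => Mm; last by rewrite bin_small // !(mul0r, mulr0).
rewrite CE //; move: pn (natr_fact_neq0 C (m i1)) (natr_fact_neq0 C (m i1 - M)).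
move: (natr_fact_neq0 C M) (natr_fact_neq0 C k) (natr_fact_neq0 C (k + M)).
set a := \prod_(i < N | _) _; set b := ((m i1)`!)%:R; set c := ((m i1 - M)`!)%:R.
set e := (M`!)%:R; set f := (k`!)%:R; set g := ((k + M)`!)%:R.
move=> e0 f0 g0 a0 b0 c0; rewrite /= mul1r; field.
by rewrite a0 c0 e0 f0 g0.
Qed.

End OccupationVectors.

(** * Rigidity of vectors attaining the largest eigenvalue *)

Section Extremal.
Variables (N : nat) (C : numClosedFieldType).
Local Notation P := (symP C N).

(** Exchanging the first letter of [h0] with the [i]-th letter of [t] preserves the total
    occupation. It replaces that letter by [a0] at the cost of a factor [x (t i)]; doing this for
    every [i] leaves a constant word. *)
Lemma product_of_symmetric k M (chi : Idx N k -> C) (psi : Idx N M -> C) h0 :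
  (0 < k)%N -> chi h0 != 0 ->
  (forall h t h' t', oadd (occ h) (occ t) = oadd (occ h') (occ t') ->
     chi h * psi t = chi h' * psi t') ->
  exists c, exists x : 'I_N -> C, forall t, psi t = c * \prod_i x (t i).
Proof.
move=> k0 chi0 sym; pose j0 := Ordinal k0; pose a0 := h0 j0.
pose x b := chi [ffun j => if j == j0 then b else h0 j] / chi h0.
exists (psi [ffun=> a0]), x => t.
have step (s : Idx N M) i :
    psi s = x (s i) * psi [ffun j => if j == i then a0 else s j].
  apply: (mulfI chi0); rewrite mulrA [chi h0 * x _]mulrC divfK //.
  apply: sym; apply/ffunP=> b; rewrite !ffunE.
  rewrite (bigD1 j0) //= [X in (_ + X)%N](bigD1 i) //=.
  rewrite [in RHS](bigD1 j0) //= [X in _ = (_ + X)%N](bigD1 i) //= !ffunE !eqxx.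
  have -> : (\sum_(j < k | j != j0) (([ffun j' => if j' == j0 then s i else h0 j']
      : Idx N k) j == b) = \sum_(j < k | j != j0) (h0 j == b))%N.
    by apply: eq_bigr => j /negPf nj; rewrite ffunE nj.
  have -> : (\sum_(j < M | j != i) (([ffun j' => if j' == i then a0 else s j']
      : Idx N M) j == b) = \sum_(j < M | j != i) (s j == b))%N.
    by apply: eq_bigr => j /negPf nj; rewrite ffunE nj.
  by rewrite -/a0 addnACA [in RHS]addnACA [((a0 == b) + _)%N]addnC.
pose tm q : Idx N M := [ffun i : 'I_M => if (i < q)%N then a0 else t i].
have main q : (q <= M)%N -> psi t = (\prod_(i < M | (i < q)%N) x (t i)) * psi (tm q).
  elim: q => [|q IH] qM.
    rewrite big_pred0 // mul1r; congr psi; apply/ffunP=> i; by rewrite ffunE.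
  rewrite (IH (ltnW qM)) (step (tm q) (Ordinal qM)) mulrA; congr (_ * _).
    rewrite [in RHS](bigD1 (Ordinal qM)) //= mulrC; congr (x _ * _).
      by rewrite ffunE /= ltnn.
    by apply: eq_bigl => i; rewrite -val_eqE /= ltnS andbC -ltn_neqAle.
  congr psi; apply/ffunP=> i; rewrite !ffunE -val_eqE /= ltnS.
  by case: (ltngtP (i : nat) q).
rewrite (main M) // mulrC; congr (_ * _).
  by congr psi; apply/ffunP=> i; rewrite !ffunE ltn_ord.
by apply: eq_bigl => i; rewrite ltn_ord.
Qed.

Lemma psd_spectral n (A : 'M[C]_n) : psd A ->
  (forall i, 0 <= spectral_diag A 0 i) /\
  A = \sum_i spectral_diag A 0 i *: ketbra ((row i (spectralmx A))^t*).
Proof.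
move=> [AH Apos]; have Uu := spectral_unitarymx A.
have D := hermitian_spectral AH; set U := spectralmx A in Uu D *; split=> [i|].
  have := Apos ((row i U)^t*); rewrite trmxCK.
  suff -> : (row i U *m A *m (row i U)^t*) 0 0 = spectral_diag A 0 i by [].
  have <- : (U *m A *m U^t*) i i = spectral_diag A 0 i by rewrite D mxE eqxx.
  rewrite !mxE; apply: eq_bigr => a _; rewrite !mxE; congr (_ * _).
  by apply: eq_bigr => b _; rewrite !mxE.
have AE : A = U^t* *m diag_mx (spectral_diag A) *m U.
  by rewrite -D !mulmxA (mulmx1C (unitarymxP Uu)) mul1mx -mulmxA
    (mulmx1C (unitarymxP Uu)) mulmx1.
rewrite {1}AE; apply/matrixP=> a b; rewrite mxE summxE; apply: eq_bigr => i _.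
rewrite mul_mx_diag !mxE big_ord1 !mxE conjCK.
ring.
Qed.

(** In an eigenbasis of [rho], the eigenvalues [d] and the squared column norms [y] of [O] are two
    probability vectors with scalar product 1. Hence [y] is 1 wherever [d] is nonzero, and both are
    concentrated at one common index. *)
Lemma pure_of_top n q (rho : 'M[C]_n) (O : 'M[C]_(q, n)) :
  psd rho -> \tr rho = 1 -> \tr (O *m rho *m O^t*) = 1 -> \tr (O *m O^t*) = 1 ->
  exists c : 'cV[C]_q, exists p : 'cV[C]_n, rho = ketbra p /\ O = c *m p^t*.
Proof.
move=> rpsd tr1 top1 norm1; have [r0 rE] := psd_spectral rpsd.
have D := hermitian_spectral rpsd.1; have Uu := spectral_unitarymx rho.
move: r0 rE D Uu; set U := spectralmx rho; set d := spectral_diag rho => r0 rE D Uu.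
have UU := mulmx1C (unitarymxP Uu).
pose Y := O *m U^t*; pose y i := \sum_h `|Y h i| ^+ 2.
have sr : \sum_i d 0 i = 1.
  by rewrite -mxtrace_diag -D mxtrace_mulC mulmxA UU mul1mx.
have sy : \sum_i y i = 1.
  rewrite -norm1 exchange_big -(mxtrace_gram Y) /Y trmxC_mul trmxCK mulmxA.
  by rewrite -[O *m _ *m U]mulmxA UU mulmx1.
have ry : \sum_i d 0 i * y i = 1.
  rewrite -top1 (_ : O *m rho *m O^t* = Y *m diag_mx d *m Y^t*); last first.
    rewrite -D /Y trmxC_mul trmxCK !mulmxA -[O *m _ *m U]mulmxA UU mulmx1.
    by rewrite -[_ *m U^t* *m U]mulmxA UU mulmx1.
  under eq_bigr do rewrite mulr_sumr.
  rewrite exchange_big; apply: eq_bigr => h _; rewrite mul_mx_diag mxE.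
  by apply: eq_bigr => i _; rewrite !mxE normCK; ring.
have y0 i : 0 <= y i by apply: sumr_ge0 => h _; exact: exprn_ge0.
have y1 i : y i <= 1 by rewrite -sy (bigD1 i) //= lerDl sumr_ge0.
have dy i : d 0 i != 0 -> y i = 1.
  move=> di; apply/eqP; rewrite eq_sym -subr_eq0.
  have : \sum_i d 0 i * (1 - y i) = 0.
    by under eq_bigr do rewrite mulrBr mulr1; rewrite sumrB sr ry subrr.
  move/eqP; rewrite psumr_eq0 => [|j _]; last by rewrite mulr_ge0 ?subr_ge0.
  by move/allP/(_ i (mem_index_enum _)); rewrite /= mulf_eq0 (negPf di).
have [i di] : exists i, d 0 i != 0.
  apply/existsP; rewrite -negb_forall; apply/negP => /forallP w0.
  move/eqP: sr; rewrite big1 ?(eq_sym 0) ?oner_eq0 // => i _; exact/eqP/w0.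
have yj j : j != i -> y j = 0.
  move=> ji; move: sy; rewrite (bigD1 i) //= dy // => /(canRL (addKr _)).
  rewrite addNr => /eqP; rewrite psumr_eq0 // => /allP/(_ j (mem_index_enum _)).
  by rewrite ji => /eqP.
have dj j : j != i -> d 0 j = 0.
  move=> ji; apply/eqP; apply: contraTT isT => /dy; rewrite yj // => /eqP.
  by rewrite eq_sym oner_eq0.
have d1 : d 0 i = 1.
  by rewrite -sr (bigD1 i) //= big1 ?addr0.
exists (col i Y), ((row i U)^t*); split.
  by rewrite {1}rE (bigD1 i) //= d1 scale1r big1 ?addr0 // => j /dj ->; rewrite scale0r.
have {1}-> : O = Y *m U by rewrite /Y -mulmxA UU mulmx1.
rewrite trmxCK; apply/matrixP=> h a; rewrite !mxE (bigD1 i) //= big1 => [|j ji].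
  by rewrite addr0 big_ord1 !mxE.
have : Y h j == 0.
  have /eqP := yj j ji; rewrite psumr_eq0 => [|h' _]; last exact: exprn_ge0.
  by move/allP/(_ h (mem_index_enum _)); rewrite /= expf_eq0 normr_eq0.
by rewrite !mxE => /eqP->; rewrite mul0r.
Qed.

Lemma product_of_top k M (rho : 'M[C]_(tdim N M)) (w : 'rV[C]_(tdim N (k + M))) :
  (0 < k)%N -> (0 < M)%N -> psd rho -> \tr rho = 1 ->
  w *m P (k + M) = w -> (w *m w^t*) 0 0 = 1 ->
  (w *m idtens k rho *m w^t*) 0 0 = 1 ->
  exists v : 'cV[C]_N, unit_vector v /\ rho = ketbra (tensorpow M v).
Proof.
move=> k0 M0 rpsd tr1 wP w1 top1.
have wE a b : occ (ix a) = occ (ix b) -> w 0 a = w 0 b.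
  move=> e; rewrite -wP !mxE; apply: eq_bigr => c _.
  by rewrite symP_sym [in RHS]symP_sym !symPE e.
(* The vector is read as a matrix between the first [k] and the last [M] factors; this turns the
   expectation of [idtens k rho] into the trace of [O rho O^*]. *)
pose O : 'M[C]_(tdim N k, tdim N M) := \matrix_(h, t) w 0 (rk (wcat (ix h, ix t))).
have OO : \tr (O *m O^t*) = 1.
  rewrite -w1 mxE mxtrace_gram.
  transitivity (\sum_(x : Idx N (k + M)) `|w 0 (rk x)| ^+ 2).
    rewrite sum_wcat -sum_ix; apply: eq_bigr => h _.
    by rewrite -sum_ix; apply: eq_bigr => t _; rewrite !mxE.
  by rewrite -sum_ix; apply: eq_bigr => a _; rewrite !mxE ixK normCK.
have OrO : \tr (O *m rho *m O^t*) = 1.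
  rewrite -top1 mxE.
  transitivity (\sum_(x : Idx N (k + M)) \sum_(y : Idx N (k + M))
     w 0 (rk y) * ((whead y == whead x)%:R * rho (rk (wtail y)) (rk (wtail x)))
       * (w 0 (rk x))^*); last first.
    rewrite -sum_ix; apply: eq_bigr => a _; rewrite !mxE mulr_suml -sum_ix ixK.
    by apply: eq_bigr => b _; rewrite !mxE ixK.
  rewrite sum_wcat -sum_ix; apply: eq_bigr => h _; rewrite mxE -sum_ix.
  apply: eq_bigr => t _; rewrite !mxE mulr_suml sum_wcat.
  rewrite (bigD1 (ix h)) //= [X in _ + X]big1 => [|h' nh]; last first.
    by apply: big1 => t' _; rewrite !whead_wcat (negPf nh) mul0r mulr0 mul0r.
  rewrite addr0 -sum_ix; apply: eq_bigr => t' _.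
  by rewrite !whead_wcat !wtail_wcat eqxx mul1r !ixK !mxE.
have [c [p [rE OE]]] := pure_of_top rpsd tr1 OrO OO.
have OE' h t : w 0 (rk (wcat (h, t))) = c (rk h) 0 * (p (rk t) 0)^*.
  have := congr1 (fun A : 'M_(_, _) => A (rk h) (rk t)) OE.
  by rewrite !mxE big_ord1 !mxE !rkK.
have [h0 ch0] : exists h0, c (rk h0) 0 != 0.
  apply/existsP; rewrite -negb_forall; apply/negP => /forallP c0.
  move/eqP: OO; rewrite OE (_ : c = 0) ?mul0mx ?mxtrace0 ?(eq_sym 0) ?oner_eq0 //.
  by apply/colP=> h; rewrite mxE; have /eqP := c0 (ix h); rewrite ixK.
have [|z [x zx]] := @product_of_symmetric k M (fun h => c (rk h) 0)
    (fun t => (p (rk t) 0)^*) h0 k0 ch0.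
  move=> h t h' t' e; rewrite -!OE'; apply: wE.
  by rewrite !rkK !occ_wcat.
(* An [M]-th root spreads the scalar over the [M] factors. Conjugates appear because [w] is a row
   vector. That [v] is a unit vector follows at the end from the trace of [rho], the [M]-th power of
   its squared norm. *)
have [b bM] : exists b : C, b ^+ M = z^*.
  by exists (M.-root z^*); rewrite rootCK.
pose v : 'cV[C]_N := \col_i (b * (x i)^*).
have pv : p = tensorpow M v.
  apply/colP=> t; rewrite mxE; have := congr1 (fun s : C => s^*) (zx (ix t)); rewrite /=.
  rewrite ixK conjCK => ->; rewrite rmorphM /= rmorph_prod -bM.
  rewrite -[in X in b ^+ X](card_ord M) -prodr_const -big_split /=.
  by apply: eq_bigr => i _; rewrite mxE.
exists v; split; last by rewrite rE pv.
have : ((v^t* *m v) 0 0) ^+ M = 1.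
  by rewrite -tensorpow_dot -pv -tr1 rE /ketbra mxtrace_mulC trace_mx11.
have v0 : 0 <= (v^t* *m v) 0 0.
  by rewrite mxE sumr_ge0 // => i _; rewrite !mxE mulrC mul_conjC_ge0.
by move/eqP; rewrite pexpr_eq1 // => /eqP.
Qed.

End Extremal.

(** * The cloning channel *)

Lemma trf_onE (C : numClosedFieldType) n (P A : 'M[C]_n) :
  P *m P = P -> P^t* = P -> A^t* = A ->
  exists lam : 'rV[C]_(\rank P), exists W : 'M[C]_(\rank P, n),
    [/\ W \is unitarymx, W^t* *m W = P, W *m A *m W^t* = diag_mx lam &
        forall f, trf_on f P A = \sum_i f (lam 0 i)].
Proof.
move=> PP PC AH; set V := schmidt (row_base P); pose B := V *m A *m V^t*.
have BH : B^t* = B by rewrite /B !trmxC_mul trmxCK AH mulmxA.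
have Uu := spectral_unitarymx B; have Vu : V \is unitarymx := range_basis_unitary P.
exists (spectral_diag B), (spectralmx B *m V); split=> //.
- exact: mul_unitarymx.
- rewrite trmxC_mul mulmxA -[V^t* *m _ *m _]mulmxA (mulmx1C (unitarymxP Uu)).
  by rewrite mulmx1 range_basisK.
- by rewrite -(hermitian_spectral BH) trmxC_mul /B !mulmxA.
Qed.

Section Cloning.
Variables (N : nat) (C : numClosedFieldType) (i0 : 'I_N) (M k : nat).
Local Notation P := (symP C N).
Local Notation n := (k + M)%N.

Let prefactor : C :=
  ((M + N).-1`!)%:R / ((n + N).-1`!)%:R * ((n`!)%:R / (M`!)%:R).

Let N0 : (0 < N)%N. Proof. by case: (N) i0 => [[]|]. Qed.

Let prefactor_gt0 : 0 < prefactor.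
Proof. by rewrite mulr_gt0 ?divr_gt0 // ltr0n fact_gt0. Qed.

(** The prefactor is the ratio of the dimensions of the symmetric subspaces for [M] and for [n]
    particles. The bound keeps all spectra in [0,1], where [f] is concave. *)
Let prefactor_le1 : prefactor <= 1.
Proof.
have factE m : ((m + N).-1`!)%:R = ('C(m + N.-1, N.-1))%:R * ((m`!)%:R * ((N.-1)`!)%:R) :> C.
  rewrite -!natrM (_ : (m + N).-1 = m + N.-1)%N; last by move: N0; lia.
  by rewrite -(bin_fact (leq_addl m N.-1)) addnK [((N.-1)`! * _)%N]mulnC.
have b0 m : 'C(m + N.-1, N.-1)%:R != 0 :> C.
  by rewrite pnatr_eq0 -lt0n bin_gt0 leq_addl.
have -> : prefactor = 'C(M + N.-1, N.-1)%:R / 'C(n + N.-1, N.-1)%:R.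
  rewrite /prefactor !factE; move: (b0 n) (natr_fact_neq0 C n).
  move: (natr_fact_neq0 C M) (natr_fact_neq0 C N.-1).
  set a := (M`!)%:R; set b := ((N.-1)`!)%:R; set c := 'C(n + _, _)%:R.
  set d := (n`!)%:R => a0 bn0 c0 d0; field; by rewrite a0 bn0 c0 d0.
rewrite ler_pdivrMr ?mul1r ?ler_nat ?leq_bin2l //; first by rewrite leq_add2r leq_addl.
by rewrite lt0r b0 ler0n.
Qed.

Lemma calThE (rho : 'M[C]_(tdim N M)) :
  calTh k rho = prefactor *: (P n *m idtens k rho *m P n).
Proof. by rewrite /calTh /calT scalerA. Qed.

Lemma idtens_conj (rho : 'M[C]_(tdim N M)) : (idtens k rho)^t* = idtens k (rho^t*).
Proof.
apply/matrixP=> a b; rewrite !mxE rmorphM /= conjC_nat eq_sym.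
by [].
Qed.

Lemma calTh_conj (rho : 'M[C]_(tdim N M)) : rho^t* = rho ->
  (calTh k rho)^t* = calTh k rho.
Proof.
move=> rH; rewrite calThE linearZ /= map_mxZ /= (geC0_conj (ltW prefactor_gt0)).
by rewrite !trmxC_mul symP_conj idtens_conj rH mulmxA.
Qed.

Lemma calTh_symP (rho : 'M[C]_(tdim N M)) : P n *m calTh k rho *m P n = calTh k rho.
Proof.
rewrite calThE -scalemxAr -scalemxAl !mulmxA symP_idem.
by rewrite -[_ *m P n *m P n]mulmxA symP_idem.
Qed.

(* The spectrum of the image of a coherent state, in decreasing order. *)
Definition cohspec p : C :=
  prefactor / 'C(n, M)%:R * (cohw M n (exc N n p))%:R.

Let bin_nM : 0 < 'C(n, M)%:R :> C.
Proof. by rewrite ltr0n bin_gt0 leq_addl. Qed.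

Let cohspec01 p : 0 <= cohspec p <= 1.
Proof.
rewrite /cohspec mulr_ge0 ?divr_ge0 ?ler0n ?(ltW prefactor_gt0) //=.
rewrite -mulrA -[leRHS]mulr1 ler_pM ?prefactor_le1 ?(ltW prefactor_gt0) //.
  by rewrite mulr_ge0 ?invr_ge0 ?ler0n.
rewrite mulrC ler_pdivrMr // mul1r ler_nat /cohw; case: ifP => // _.
by rewrite leq_bin2l // leq_subr.
Qed.

Let cohspec_mono p q : (p < q)%N -> cohspec q <= cohspec p.
Proof.
move=> pq; rewrite ler_wpM2l ?divr_ge0 ?ler0n ?(ltW prefactor_gt0) //.
have pq' := exc_leq2 i0 n (ltnW pq).
rewrite ler_nat /cohw; case: (leqP (exc N n q) n) => // qn.
by rewrite (leq_trans pq' qn) leq_bin2l // leq_sub2l.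
Qed.

Let cohspec0 : cohspec 0 = prefactor.
Proof.
rewrite /cohspec (_ : exc N n 0 = 0)%N; last first.
  by apply/eqP; rewrite -leqn0 (exc_le i0) // symdim0.
by rewrite /cohw subn0 divfK ?gt_eqF.
Qed.

Section Density.
Variable rho : 'M[C]_(tdim N M).
Hypothesis rho_density : density_on (P M) rho.

(** The eigenvectors of [rho] in the full space need not be symmetric, hence the weights [symnorm];
    their weighted total is the trace of [P_M rho]. *)
Let rho_decomp : exists r : 'I_(tdim N M) -> C, exists phi : 'I_(tdim N M) -> 'cV[C]_(tdim N M),
  [/\ forall i, 0 <= r i, \sum_i r i * symnorm (phi i) = 1 &
   calTh k rho = prefactor *: \sum_i r i *: (creat n k (phi i) *m (creat n k (phi i))^t*)].
Proof.
have [rpsd [tr1 rP]] := rho_density; have [r0 rE] := psd_spectral rpsd.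
exists (fun i => spectral_diag rho 0 i), (fun i => (row i (spectralmx rho))^t*).
split=> //; last first.
  rewrite calThE {1}rE idtens_sum mulmx_sumr mulmx_suml; congr (_ *: _).
  by apply: eq_bigr => i _; rewrite -scalemxAr -scalemxAl sym_idtens_ketbra.
transitivity (\tr (P M *m rho)).
  rewrite [in RHS]rE mulmx_sumr raddf_sum; apply: eq_bigr => i _.
  by rewrite -scalemxAr /= mxtraceZ.
by rewrite -tr1 [in RHS]rP [in RHS]mxtrace_mulC [in RHS]mulmxA symP_idem.
Qed.

Lemma calTh_top j (V : 'M[C]_(j, tdim N n)) : V \is unitarymx ->
  \tr (V *m calTh k rho *m V^t*) <= \sum_(p < j) cohspec p.
Proof.
move=> Vu; have [r [phi [r0 r1 ->]]] := rho_decomp.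
rewrite -scalemxAr -scalemxAl mxtraceZ -mulr_sumr -mulrA ler_wpM2l ?(ltW prefactor_gt0) //.
rewrite mulrC ler_pdivlMr // mulrC -[leRHS]mul1r -[X in _ <= X * _]r1 mulr_suml.
rewrite mulmx_sumr mulmx_suml raddf_sum mulr_sumr; apply: ler_sum => i _.
rewrite -scalemxAr -scalemxAl /= mxtraceZ mulrCA -mulrA ler_wpM2l //.
exact: (creat_top i0).
Qed.

Lemma calTh_trace : \tr (calTh k rho) = \sum_(p < symdim N n n) cohspec p.
Proof.
have [r [phi [r0 r1 ->]]] := rho_decomp.
rewrite mxtraceZ -mulr_sumr -mulrA; congr (_ * _).
apply: (mulfI (lt0r_neq0 bin_nM)); rewrite mulrA divff ?gt_eqF // -[X in _ = X * _]r1 mulr_suml.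
rewrite raddf_sum mulr_sumr; apply: eq_bigr => i _.
have := @creat_trace N C i0 n n k M (phi i) erefl (leqnn n); cbv zeta => H.
by rewrite /= mxtraceZ mulrCA -[in RHS]mulrA -H.
Qed.

Lemma calTh_ge0 (w : 'rV[C]_(tdim N n)) : 0 <= (w *m calTh k rho *m w^t*) 0 0.
Proof.
have [r [phi [r0 _ ->]]] := rho_decomp.
rewrite -trace_mx11 -scalemxAr -scalemxAl mxtraceZ mulr_ge0 ?(ltW prefactor_gt0) //.
rewrite mulmx_sumr mulmx_suml raddf_sum sumr_ge0 // => i _.
rewrite -scalemxAr -scalemxAl /= mxtraceZ mulr_ge0 //.
set X := creat _ _ _; rewrite (_ : _ *m _ *m _ = (w *m X) *m (w *m X)^t*).
  exact: mxtrace_gram_ge0.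
by rewrite trmxC_mul !mulmxA.
Qed.

Lemma calTh_spectrum :
  exists lam : 'I_(symdim N n n) -> C, exists W : 'M[C]_(symdim N n n, tdim N n),
  [/\ W \is unitarymx, W^t* *m W = P n,
      W *m calTh k rho *m W^t* = diag_mx (\row_i lam i),
      forall i, 0 <= lam i <= 1 &
      forall f, trf_on f (P n) (calTh k rho) = \sum_i f (lam i)].
Proof.
have [lam [W [Wu WW Wd trfE]]] := trf_onE (symP_idem N C n) (symP_conj N C n)
  (calTh_conj rho_density.1.1).
(* The rank occurs in the types of [lam] and [W], so all of them are transported along its equality
   with [symdim]. *)
have rk := symP_rank N C (leqnn n); case: _ / rk in lam W Wu WW Wd trfE *.
exists (fun i => lam 0 i), W; split=> // [|i].
  by rewrite Wd; congr diag_mx; apply/rowP=> i; rewrite mxE.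
have lamE : lam 0 i = \tr (row i W *m calTh k rho *m (row i W)^t*).
  have <- : (W *m calTh k rho *m W^t*) i i = lam 0 i by rewrite Wd mxE eqxx.
  rewrite trace_mx11 !mxE; apply: eq_bigr => a _; rewrite !mxE; congr (_ * _).
  by apply: eq_bigr => b _; rewrite !mxE.
rewrite lamE; apply/andP; split; first by rewrite trace_mx11 calTh_ge0.
have rWu : row i W \is unitarymx.
  apply/unitarymxP; rewrite [row i W]rowE trmxC_mul mulmxA.
  rewrite -[_ *m W *m _]mulmxA (unitarymxP Wu) mulmx1.
  by apply/matrixP=> a b; rewrite !ord1 -rowE !mxE !eqxx conjC1.
apply: le_trans (calTh_top rWu) _; rewrite big_ord1.
by case/andP: (cohspec01 0).
Qed.

Variable f : C -> C.
Hypothesis fconc : concave01 f.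

(** Collects the hypotheses of Karamata's inequality. The partial sums are bounded by testing
    [calTh_top] on the eigenvectors of the [j] largest eigenvalues. *)
Let spectrum_sorted : exists lam : 'I_(symdim N n n) -> C,
  exists W : 'M[C]_(symdim N n n, tdim N n),
  exists e : nat -> 'I_(symdim N n n),
  [/\ W \is unitarymx /\ W^t* *m W = P n,
      W *m calTh k rho *m W^t* = diag_mx (\row_i lam i),
      trf_on f (P n) (calTh k rho) = \sum_(p < symdim N n n) f (lam (e p)),
      (forall p, (p < symdim N n n)%N -> 0 <= lam (e p) <= 1) &
    [/\ forall p q, (p < q < symdim N n n)%N -> lam (e q) <= lam (e p),
      forall j, (j <= symdim N n n)%N ->
        \sum_(p < j) lam (e p) <= \sum_(p < j) cohspec p &
      \sum_(p < symdim N n n) lam (e p) = \sum_(p < symdim N n n) cohspec p]].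
Proof.
have [lam [W [Wu WW Wd lam01 trfE]]] := calTh_spectrum.
have D0 : (0 < symdim N n n)%N.
  by apply: leq_trans (symdim_mono i0 (leq0n n) (leqnn n)); rewrite symdim0.
have lamr i : lam i \is Num.real by case/andP: (lam01 i) => /ger0_real.
have [e [es eF eI]] := sort_family lamr D0.
exists lam, W, e; split=> //; first by rewrite trfE eF.
split=> //.
- move=> j jD; apply: le_trans (calTh_top (rowsub_unitary (eI j jD) Wu)).
  rewrite /mxtrace; apply: ler_sum => a _; rewrite quad_rowsub Wd mxE eqxx.
  by rewrite mxE mulr1n.
rewrite (eF id) -calTh_trace; transitivity (\tr (diag_mx (\row_i lam i))).
  by rewrite mxtrace_diag; apply: eq_bigr => i _; rewrite mxE.
rewrite -Wd mxtrace_mulC mulmxA WW -[in RHS]calTh_symP.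
by rewrite [in RHS]mxtrace_mulC [in RHS]mulmxA symP_idem.
Qed.

Lemma trf_calTh_ge : \sum_(p < symdim N n n) f (cohspec p) <=
  trf_on f (P n) (calTh k rho).
Proof.
have [lam [W [e [_ _ -> lam01 [es maj tot]]]]] := spectrum_sorted.
exact: (karamata_seq fconc (x := fun p => lam (e p))).
Qed.

Lemma trf_calTh_eq : strictly_concave01 f -> (0 < k)%N -> (0 < M)%N ->
  trf_on f (P n) (calTh k rho) = \sum_(p < symdim N n n) f (cohspec p) ->
  exists w : 'cV[C]_N, unit_vector w /\ rho = ketbra (tensorpow M w).
Proof.
move=> fs k0 M0.
have [lam [W [e [[Wu WW] Wd -> lam01 [es maj tot]]]]] := spectrum_sorted => feq.
have D0 : (0 < symdim N n n)%N by apply: leq_ltn_trans (ltn_ord (e 0%N)).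
have := @karamata_strict C f fconc _ (fun p => lam (e p)) cohspec fs D0 lam01
  cohspec01 es cohspec_mono maj tot feq.
(* The largest value of [cohspec] is exactly the prefactor; dividing it out leaves expectation 1 of
   [idtens k rho] in the eigenvector [row i W]. *)
rewrite cohspec0 => top; set i := e 0%N in top.
have [rpsd [tr1 rP]] := rho_density.
have wP : row i W *m P n = row i W.
  by rewrite -WW rowE -mulmxA [W *m _]mulmxA (unitarymxP Wu) mul1mx.
apply: (@product_of_top N C k M rho (row i W)) => //.
- transitivity ((W *m W^t*) i i); last by rewrite (unitarymxP Wu) mxE eqxx.
  by rewrite !mxE; apply: eq_bigr => a _; rewrite !mxE.
apply: (mulfI (lt0r_neq0 prefactor_gt0)); rewrite mulr1 -[RHS]top.
have <- : (W *m calTh k rho *m W^t*) i i = lam i by rewrite Wd !mxE eqxx mulr1n.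
transitivity ((row i W *m calTh k rho *m (row i W)^t*) 0 0); last first.
  rewrite !mxE; apply: eq_bigr => a _; rewrite !mxE; congr (_ * _).
  by apply: eq_bigr => b _; rewrite !mxE.
rewrite calThE -scalemxAr -scalemxAl [RHS]mxE; congr (_ * _).
rewrite -[P n *m _ *m P n]mulmxA [row i W *m (P n *m _)]mulmxA wP.
have Pw : P n *m (row i W)^t* = (row i W)^t*.
  by rewrite -{1}(symP_conj N C n) -trmxC_mul wP.
by rewrite [_ *m (_ *m P n)]mulmxA -[_ *m P n *m _]mulmxA Pw.
Qed.

End Density.

Lemma coherent_density (u : 'cV[C]_N) : unit_vector u ->
  density_on (P M) (ketbra (tensorpow M u)).
Proof.
move=> uu; have Pu : P M *m tensorpow M u = tensorpow M u.
  apply: symP_occ => a b /occ_perm[s e]; rewrite !mxE.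
  rewrite [RHS](reindex_inj (@perm_inj _ s)).
  by apply: eq_bigr => i _; rewrite e.
split; [split|split].
- by rewrite trmxC_mul trmxCK.
- move=> v; rewrite -trace_mx11 (_ : _ *m _ *m _ = (v^t* *m tensorpow M u) *m
    (v^t* *m tensorpow M u)^t*); first exact: mxtrace_gram_ge0.
  by rewrite trmxC_mul trmxCK !mulmxA.
- by rewrite mxtrace_mulC trace_mx11 tensorpow_dot uu expr1n.
rewrite /ketbra mulmxA Pu -mulmxA -{1}(symP_conj N C M) -trmxC_mul.
by rewrite Pu.
Qed.

(** The values of [cohspec] are the diagonal entries of the output in the rotated occupation basis.
    The squared overlaps [t] of that basis with an eigenbasis are doubly stochastic, so Jensen's
    inequality in each row, summed over rows, bounds the [f]-sum of the spectrum by that of the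
    diagonal. *)
Lemma trf_coherent_le (f : C -> C) (u : 'cV[C]_N) : concave01 f -> unit_vector u ->
  trf_on f (P n) (calTh k (ketbra (tensorpow M u))) <=
  \sum_(p < symdim N n n) f (cohspec p).
Proof.
move=> fconc uu; have ud := coherent_density uu.
have [lam [W [Wu WW Wd lam01 ->]]] := calTh_spectrum ud.
have [U [i1 Uu [w0 w1]]] := unitary_to_axis uu.
set A := calTh k _ in Wd; set R := tpow n U.
have RR : R^t* *m R = 1%:M := mulmx1C (unitarymxP (tpow_unitary n Uu)).
pose z (x : {ffun 'I_N -> 'I_n.+1}) := (occvec C n (ocast x))^t* *m R.
pose t x i := occw C n (ocast x) * `|(z x *m W^t*) 0 i| ^+ 2.
have t0 x i : 0 <= t x i by rewrite mulr_ge0 ?exprn_ge0 // ltW // occw_gt0.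
have PR : P n *m R^t* = R^t* *m P n by rewrite tpow_conj tpow_symP.
have zP x : z x *m P n = z x.
  rewrite /z -mulmxA tpow_symP mulmxA -{1}(symP_conj N C n) -trmxC_mul.
  by rewrite symP_occvec.
have sx (x : {ffun 'I_N -> 'I_n.+1}) : (\sum_i ocast x i = \sum_i x i)%N.
  by apply: eq_bigr => i _; rewrite ffunE.
have zW x : z x *m W^t* *m W = z x by rewrite -mulmxA WW zP.
(* Applied to the symmetrizer this gives the row sums of [t], applied to the output [A] its diagonal
   entries. *)
have quadE x (B : 'M[C]_(tdim N n)) (y : 'rV[C]_(symdim N n n)) :
    W *m B *m W^t* = diag_mx y ->
    \sum_i t x i * y 0 i = occw C n (ocast x) * (z x *m B *m (z x)^t*) 0 0.
  move=> WB; have -> : z x *m B *m (z x)^t* =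
      (z x *m W^t*) *m diag_mx y *m (z x *m W^t*)^t*.
    by rewrite -[in LHS](zW x) [in LHS]trmxC_mul -WB !mulmxA.
  rewrite mul_mx_diag [X in _ = _ * X]mxE mulr_sumr; apply: eq_bigr => i _.
  by rewrite /t [in RHS]mxE [X in _ = _ * (_ * X)]mxE [X in _ = _ * (_ * _ X)]mxE normCK; ring.
have t1 (x : {ffun 'I_N -> 'I_n.+1}) : (\sum_i x i == n)%N -> \sum_i t x i = 1.
  move=> /eqP xn; transitivity (\sum_i t x i * (const_mx 1 : 'rV[C]_(symdim N n n)) 0 i).
    by apply: eq_bigr => i _; rewrite mxE mulr1.
  rewrite (quadE x (P n)); last first.
    by rewrite -WW mulmxA (unitarymxP Wu) mul1mx (unitarymxP Wu) diag_const_mx.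
  rewrite zP /z trmxC_mul trmxCK mulmxA -[_ *m R *m _]mulmxA.
  rewrite (unitarymxP (tpow_unitary n Uu)) mulmx1 occvec_norm //.
  by rewrite sx.
have tlam (x : {ffun 'I_N -> 'I_n.+1}) : (\sum_i x i == n)%N -> \sum_i t x i * lam i =
    prefactor / 'C(n, M)%:R * (cohw M n (n - x i1))%:R.
  move=> /eqP xn; transitivity (\sum_i t x i * (\row_i lam i) 0 i).
    by apply: eq_bigr => i _; rewrite mxE.
  have xi : (x i1 <= n)%N by rewrite -[leqRHS]xn (bigD1 i1) //= leq_addr.
  rewrite (quadE x A) // /A calThE idtens_ketbra.
  have -> : z x *m (prefactor *: (P n *m (tensl k (tensorpow M u) *m
      (tensl k (tensorpow M u))^t*) *m P n)) *m (z x)^t* =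
      prefactor *: (z x *m (P n *m tensl k (tensorpow M u)) *m
        (z x *m (P n *m tensl k (tensorpow M u)))^t*).
    rewrite -scalemxAr -scalemxAl; congr (_ *: _).
    by rewrite [in RHS]trmxC_mul [in RHS]trmxC_mul symP_conj !mulmxA.
  rewrite mxE mulrCA.
  have := @coherent_occupation N C k M (ocast x) U i1 u Uu w0 w1; cbv zeta => ->.
    by rewrite ffunE /cohw leq_subr subKn // mulrA mulrAC.
  by rewrite sx.
have tsum i : \sum_(x : {ffun 'I_N -> 'I_n.+1} | (\sum_i x i == n)%N) t x i = 1.
  transitivity ((W *m P n *m W^t*) i i); last first.
    by rewrite -WW mulmxA (unitarymxP Wu) mul1mx (unitarymxP Wu) mxE eqxx.
  have -> : P n = R^t* *m P n *m R by rewrite -PR -mulmxA RR mulmx1.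
  rewrite -(sum_occvec N C (leqnn n)) mulmx_sumr mulmx_suml mulmx_sumr mulmx_suml summxE.
  apply: eq_bigr => x _; rewrite -scalemxAr -scalemxAl -scalemxAr -scalemxAl mxE.
  congr (_ * _).
  have -> : W *m (R^t* *m (occvec C n (ocast x) *m (occvec C n (ocast x))^t*) *m R) *m W^t*
     = (z x *m W^t*)^t* *m (z x *m W^t*).
    by rewrite /z !trmxC_mul !trmxCK !mulmxA.
  by rewrite [in RHS]mxE big_ord1 [X in _ = X * _]mxE [X in _ = _ X * _]mxE normCKC.
rewrite -(sum_exc i1 (fun s => f (prefactor / 'C(n, M)%:R * (cohw M n s)%:R)) (leqnn n)).
apply: (@le_trans _ _ (\sum_(x : {ffun 'I_N -> 'I_n.+1} | (\sum_i x i == n)%N)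
    \sum_i t x i * f (lam i))).
  rewrite exchange_big /=; apply: ler_sum => i _.
  by rewrite -mulr_suml tsum mul1r.
apply: ler_sum => x xn; rewrite -tlam //.
exact: (jensen fconc (t0 x) (t1 x xn) lam01).
Qed.

End Cloning.

Theorem theorem2 (C : numClosedFieldType) (N M k : nat) (f : C -> C) :
  (2 <= N)%N -> (1 <= M)%N -> concave01 f ->
  (forall (rho : 'M[C]_(tdim N M)) (u : 'cV[C]_N),
     density_on (symP C N M) rho -> unit_vector u ->
     trf_on f (symP C N (k + M)) (calTh k (ketbra (tensorpow M u)))
       <= trf_on f (symP C N (k + M)) (calTh k rho)) /\
  ((2 <= M)%N -> (0 < k)%N -> strictly_concave01 f ->
   forall (rho : 'M[C]_(tdim N M)) (u : 'cV[C]_N),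
     density_on (symP C N M) rho -> unit_vector u ->
     (trf_on f (symP C N (k + M)) (calTh k rho)
        = trf_on f (symP C N (k + M)) (calTh k (ketbra (tensorpow M u)))
      <-> exists w : 'cV[C]_N, unit_vector w /\ rho = ketbra (tensorpow M w))).
Proof.
move=> N2 M1 fconc; pose i0 : 'I_N := Ordinal (ltnW N2).
(* Majorization, applied to the coherent state itself, and [trf_coherent_le] pin down its value,
   which does not depend on [u]; this also yields the converse in the case of equality. *)
have cohE (u : 'cV[C]_N) : unit_vector u ->
    trf_on f (symP C N (k + M)) (calTh k (ketbra (tensorpow M u))) =
    \sum_(p < symdim N (k + M) (k + M)) f (cohspec N C M k p).
  move=> uu; apply/eqP; rewrite eq_le (trf_coherent_le i0) //=.
  exact: (trf_calTh_ge i0 k (coherent_density M uu) fconc).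
split=> [rho u rd uu|_ k0 fs rho u rd uu].
  by rewrite cohE //; exact: (trf_calTh_ge i0 k rd fconc).
rewrite (cohE u uu); split=> [|[w [wu ->]]]; last exact: cohE.
exact: (trf_calTh_eq i0 rd fconc fs k0 M1).
Qed.
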